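(* Let $\mathbf{u} = (u(n))_{n=1}^\infty$ be a simple non-degenerate integer linear recurrence sequence of order $d \ge 2$ with a dominant root. Then, for any fixed integer $s \ge 1$, uniformly over integers $M$ with $M \ge \exp\left(N \log_3 N/\log_2 N\right)$, \[ \mathsf{M}_s(M,N) \ll N^{s - 1 + o(1)}, \] where the implied constant depends only on $s$ and $\mathbf{u}$, and $o(1)$ denotes a quantity tending to $0$ as $N \to \infty$ at a rate depending only on $s$ and $\mathbf{u}$ (and not on $M$).
   Context: An integer linear recurrence sequence of order $d \ge 1$ is a sequence of integers $\mathbf{u} = (u(n))_{n=1}^\infty$ satisfying a relation $u(n+d) = c_{d-1}u(n+d-1) + \cdots + c_0 u(n)$ for all $n = 1, 2, \ldots$, with integer coefficients $c_0, \ldots, c_{d-1}$, and not satisfying any shorter relation of this form. Its characteristic polynomial is $f(X) = X^d - c_{d-1}X^{d-1} - \cdots - c_0 \in \mathbb{Z}[X]$. The sequence is non-degenerate if there are no roots of unity among the ratios of distinct (complex) roots of $f$; here it is understood that these ratios are defined, i.e. $c_0 \ne 0$. The sequence is simple if $f$ has no multiple roots. It has a dominant root if $f$ has a root $\lambda$ with $|\lambda| > \max\{|\mu| : f(\mu) = 0,\ \mu \ne \lambda\}$. Nonzero complex numbers $\gamma_1, \ldots, \gamma_s$ are multiplicatively dependent if there exist integers $k_1, \ldots, k_s$, not all zero, such that $\gamma_1^{k_1} \cdots \gamma_s^{k_s} = 1$. For integers $M \ge 0$, $N \ge 1$, $s \ge 1$, $\mathsf{M}_s(M,N)$ denotes the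 number of $s$-tuples $(n_1, \ldots, n_s) \in (\mathbb{Z} \cap [M+1, M+N])^s$ such that $u(n_1), \ldots, u(n_s)$ (all nonzero) are multiplicatively dependent. The notation $U \ll V$ means $|U| \le cV$ for some constant $c > 0$. $\log_k$ is the $k$-fold iterated natural logarithm: for $x \ge 1$, $\log_1 x = \log x$ and $\log_k x = \log_{k-1}\left(\max\{\log x, 2\}\right)$ for $k = 2, 3, \ldots$. *)

(* Defs.v *)
From HB Require Import structures.
From mathcomp Require Import all_boot all_order all_algebra.
From mathcomp Require Import all_classical all_reals all_analysis.
From mathcomp Require Import complex.

Set Implicit Arguments.
Unset Strict Implicit.
Unset Printing Implicit Defensive.

Import Order.TTheory GRing.Theory Num.Theory.
Import numFieldNormedType.Exports.

Local Open Scope ring_scope.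

(* Sequences are indexed from 1: the value [u 0] is never used. *)
Definition lin_rec_rel (u : nat -> int) (d : nat) (c : 'I_d -> int) : Prop :=
  forall n : nat, (1 <= n)%N -> u (n + d)%N = \sum_(i < d) c i * u (n + i)%N.

Definition lin_rec_seq (u : nat -> int) (d : nat) (c : 'I_d -> int) : Prop :=
  [/\ (1 <= d)%N,
      lin_rec_rel u c
    & forall (d' : nat) (c' : 'I_d' -> int),
        (1 <= d')%N -> (d' < d)%N -> ~ lin_rec_rel u c'].

Definition rec_char_poly (d : nat) (c : 'I_d -> int) : {poly int} :=
  'X^d - \sum_(i < d) c i *: 'X^i.

Definition complex_poly (R : realType) (f : {poly int}) : {poly R[i]} :=
  map_poly intr f.

(* For [f = rec_char_poly c], the constant coefficient is [- c_0]. *)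
Definition nondegenerate_poly (R : realType) (f : {poly int}) : Prop :=
  f`_0 != 0 /\
  forall a b : R[i], root (complex_poly R f) a -> root (complex_poly R f) b ->
    a != b -> forall k : nat, (0 < k)%N -> ~~ k.-unity_root (a / b).

Definition no_multiple_root (R : realType) (f : {poly int}) : Prop :=
  forall a : R[i], root (complex_poly R f) a -> mup a (complex_poly R f) = 1%N.

Definition has_dominant_root (R : realType) (f : {poly int}) : Prop :=
  exists2 l : R[i], root (complex_poly R f) l &
    forall m : R[i], root (complex_poly R f) m -> m != l -> `|m| < `|l|.

Definition mult_dependent (F : fieldType) (s : nat) (g : 'I_s -> F) : Prop :=
  (forall i, g i != 0) /\
  exists2 k : 'I_s -> int, (exists i, k i != 0) & \prod_(i < s) g i ^ k i = 1.

Definition count_mult_dependent (R : realType) (u : nat -> int)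
    (s M N : nat) : nat :=
  #|[set n : {ffun 'I_s -> 'I_(M + N).+1} |
      [forall i, (M + 1 <= n i)%N] &&
      `[< mult_dependent (fun i => (u (n i))%:~R : R[i]) >]]|.

(* [iter_log k] is log_k for [k >= 1]; [iter_log 0] is a dummy. The iteration
   is not plain composition of [ln]: the inner logarithm is truncated at 2. *)
Fixpoint iter_log (R : realType) (k : nat) (x : R) : R :=
  match k with
  | 0 | 1 => ln x
  | k'.+1 => iter_log k' (Num.max (ln x) 2)
  end.

(* Main.v *)
Require Import Defs.
From mathcomp Require Import all_boot all_order all_algebra all_fingroup.
From mathcomp Require Import all_classical all_reals all_analysis.
From mathcomp Require Import complex.
From mathcomp Require Import zify ring lra.

(** Let [g] be the gcd of the [d] terms [u(M+1), ..., u(M+d)]; it divides every later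
    term. Since [g ^ d] divides the Hankel determinant of [u(M+1+i+j)], which is a nonzero
    constant times [det(A) ^ M] for the companion matrix [A], and
    [|det A| < |lambda| ^ d] for the dominant root [lambda], the quotients [u(m) / g] are
    still exponentially large in [M].

    Indices [M+1+h] from a set [H] of at least [K] elements determine the sequence: a nonzero
    recurrence sequence with the same characteristic polynomial has fewer than [K] zeros, by
    Skolem's p-adic method and Strassmann's bound, uniformly in the initial values. Hence some
    [d] of them give a nonzero minor of size [exp(O(N))], and any [q] such that [q g] divides
    [u(m)] for all these [m] is at most [exp(O(N))].

    A multiplicative relation whose largest exponent sits at [n_i] makes [u(n_i)] divide the
    product of the other [u(n_j)], so [u(n_i)/g] shares a factor of size at least
    [(u(n_i)/g)^(1/s)] with a power of [g] or with some [u(n_j)/g]. If a single integer [B] had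
    such large common factors with many terms, a pigeonhole argument would give [K] terms
    sharing a factor of size [exp(c M)], which is impossible once [M >= C N]. So one coordinate
    takes boundedly many values when the others are fixed: the bound holds with [o(1) = 0]. *)

Set Implicit Arguments.
Unset Strict Implicit.
Unset Printing Implicit Defensive.

Import Order.TTheory GRing.Theory Num.Theory.
Import numFieldNormedType.Exports.
Import ComplexField.Normc.

Local Open Scope nat_scope.

(** * Large common divisors *)

Lemma gcdn_mul_dvd a x y : gcdn a (x * y) %| gcdn a x * gcdn a y.
Proof.
rewrite muln_gcdr !muln_gcdl !dvdn_gcd dvdn_gcdr andbT.
by rewrite !(dvdn_mulr _ (dvdn_gcdl _ _)) dvdn_mull ?dvdn_gcdl.
Qed.

Lemma gcdn_prod_dvd (I : Type) (r : seq I) (P : pred I) (F : I -> nat) a :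
  gcdn a (\prod_(i <- r | P i) F i) %| \prod_(i <- r | P i) gcdn a (F i).
Proof.
elim/big_rec2: _ => [|i x y _ IH]; first by rewrite gcdn1.
exact: dvdn_trans (gcdn_mul_dvd _ _ _) (dvdn_mul _ IH).
Qed.

(** The lcm divides the product, and a gcd with a product divides the product of the gcds. *)
Lemma leq_gcdn_biglcm (I : Type) (r : seq I) (F : I -> nat) a Y :
  0 < a -> all (fun i => gcdn a (F i) <= Y) r ->
  gcdn a (\big[lcmn/1]_(i <- r) F i) <= Y ^ size r.
Proof.
move=> a0 le_Y; apply: leq_trans (_ : \prod_(i <- r) gcdn a (F i) <= _).
  apply: dvdn_leq; first by apply: prodn_gt0 => i; rewrite gcdn_gt0 a0.
  apply: dvdn_trans (gcdn_prod_dvd _ _ _ _).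
  rewrite dvdn_gcd dvdn_gcdl /=; apply: dvdn_trans (dvdn_gcdr _ _) _.
  elim/big_rec2: _ => // i x y _ IH.
  by rewrite dvdn_lcm dvdn_mulr //= dvdn_mull.
elim: r le_Y => [|i r IH] /=; first by rewrite big_nil.
by case/andP=> ? /IH ?; rewrite big_cons expnS leq_mul.
Qed.

(* The least common multiple divides [B], and the product exceeds it only through pairwise gcds. *)
Lemma prod_leq_lcm_pairwise (I : eqType) (r : seq I) (F : I -> nat) Y :
  (forall i, i \in r -> 0 < F i) ->
  pairwise (fun i j => gcdn (F i) (F j) <= Y) r ->
  \prod_(i <- r) F i <= (\big[lcmn/1]_(i <- r) F i) * Y ^ (size r * (size r).-1).
Proof.
elim: r => [|i r IH] /= Fpos; first by rewrite !big_nil.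
case/andP=> le_i /IH{}IH; rewrite !big_cons.
have Fi : 0 < F i by rewrite Fpos ?mem_head.
have {}IH := IH (fun j jr => Fpos j (mem_behead (s := i :: r) jr)).
apply: leq_trans (leq_mul (leqnn _) IH) _.
rewrite mulnA -(muln_lcm_gcd (F i)) -mulnA leq_mul //.
apply: leq_trans (leq_mul (leq_gcdn_biglcm Fi le_i) (leqnn _)) _.
rewrite -expnD.
case: r le_i {Fpos IH} => //= j r /andP[le_ij _].
have Y0 : 0 < Y by apply: leq_trans le_ij; rewrite gcdn_gt0 Fi.
by rewrite leq_pexp2l //; nia.
Qed.

(** The product of [2 * D] such divisors is at least [B ^ 2], while their lcm divides [B]; the
    pairwise gcds must supply the missing factor [B], and the exponent counts ordered pairs. *)
Lemma exists_large_gcd_pair (I : eqType) (r : seq I) (F : I -> nat) B D :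
  0 < B -> 0 < D -> uniq r -> size r = 2 * D ->
  (forall i, i \in r -> F i %| B /\ B <= F i ^ D) ->
  exists i j, [/\ i \in r, j \in r, i != j &
     B <= gcdn (F i) (F j) ^ (2 * D * (2 * D).-1)].
Proof.
move=> B0 D0 ur szr hF.
have Fpos i : i \in r -> 0 < F i by case/hF=> /dvdn_gt0 ->.
set E := 2 * D * (2 * D).-1; have E0 : 0 < E by rewrite /E; nia.
have [/hasP[i ir /hasP[j jr /andP[nij hB]]]|H] := boolP
  (has (fun i => has (fun j => (i != j) && (B <= gcdn (F i) (F j) ^ E)) r) r).
  by exists i, j.
exfalso.
have ubY Y : Y ^ E < B -> Y <= B.
  by move/ltnW; apply: leq_trans; rewrite -{1}(expn1 Y); case: Y => // Y; rewrite leq_pexp2l.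
have exY : exists Y, Y ^ E < B by exists 0; rewrite exp0n.
(* [Y] is the largest integer with [Y ^ E < B]; without a good pair all gcds are at most [Y], so
   [B ^ 2 <= B * Y ^ E < B ^ 2]. *)
case: (ex_maxnP exY ubY) => Y ltY maxY.
have hY i j : i \in r -> j \in r -> i != j -> gcdn (F i) (F j) <= Y.
  move=> ir jr nij; apply: maxY; rewrite ltnNge; apply: contra H => hB.
  by apply/hasP; exists i => //; apply/hasP; exists j => //; rewrite nij.
have pwY : pairwise (fun i j => gcdn (F i) (F j) <= Y) r.
  have: pairwise (fun i j => i != j) r by rewrite -uniq_pairwise.
  apply: sub_in_pairwise (allss r) => i j ir jr; exact: hY.
have := prod_leq_lcm_pairwise Fpos pwY; rewrite szr -/E => le1.
have le2 : \big[lcmn/1]_(i <- r) F i <= B.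
  apply: dvdn_leq => //; rewrite big_seq; elim/big_ind: _ => // [x y ? ?|i /hF[]//].
  by rewrite dvdn_lcm; apply/andP.
have le3 : B ^ 2 <= \prod_(i <- r) F i.
  rewrite -(leq_exp2r _ _ D0) -expnM -szr.
  rewrite (big_morph (expn^~ D) (fun x y => expnMn x y D) (exp1n D)).
  have: all (fun i => B <= F i ^ D) r by apply/allP => i /hF[].
  elim: (r) => [|i r' IH] /=; first by rewrite big_nil.
  by case/andP=> ? /IH ?; rewrite big_cons expnS leq_mul.
have: B ^ 2 < B * B.
  apply: leq_ltn_trans le3 (leq_ltn_trans (leq_trans le1 (leq_mul le2 (leqnn _))) _).
  by rewrite ltn_pmul2l.
by rewrite mulnn ltnn.
Qed.

(** Induction on [k], doubling the subset: cut [r] into [2 * D'] blocks, take from each a subset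
    with a common factor, and merge two blocks whose factors have a large gcd. *)
Lemma exists_large_gcd_subset (I : eqType) (k D : nat) : 0 < D ->
  exists L D', 0 < D' /\ forall (r : seq I) (F : I -> nat) B,
    0 < B -> uniq r -> L <= size r ->
    (forall i, i \in r -> F i %| B /\ B <= F i ^ D) ->
    exists (r' : seq I) (q : nat), [/\ uniq r', {subset r' <= r}, size r' = 2 ^ k,
      (forall i, i \in r' -> q %| F i) & B <= q ^ D'].
Proof.
move=> D0; elim: k => [|k [L [D' [D'0 IH]]]].
  exists 1, D; split=> // -[|i r] // F B B0 _ _ hF; exists [:: i], (F i).
  have [hd hB] := hF i (mem_head _ _).
  by split=> // [x|x]; rewrite inE => /eqP ->; rewrite ?mem_head.
exists (2 * D' * L), (2 * D' * (2 * D').-1); split=> [|r F B B0 ur szr hF]; first by nia.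
pose blk (b : 'I_(2 * D')) := take L (drop (b * L) r).
have blk_sub b : {subset blk b <= r} by move=> x /mem_take/mem_drop.
have blk_size b : size (blk b) = L.
  have ? := ltn_ord b; rewrite size_take size_drop.
  have ? : b.+1 * L <= size r by apply: leq_trans szr; rewrite leq_mul2r ltn_ord orbT.
  by case: ltnP; nia.
have blk_disj b b' x : x \in blk b -> x \in blk b' -> b = b'.
  have ix c : x \in blk c -> c * L <= index x r < c * L + L.
    move=> xc; have xi := xc; rewrite -index_mem blk_size in xi.
    have ? : L + c * L <= size r.
      by rewrite -mulSn; apply: leq_trans szr; rewrite leq_mul2r ltn_ord orbT.
    have -> : index x r = c * L + index x (blk c).
      rewrite -{1}(nth_index x xc) nth_take // nth_drop index_uniq //; lia.
    lia.
  move=> /ix/andP[h1 h2] /ix/andP[h3 h4]; apply/val_inj => /=.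
  case: (ltngtP b b') => // lt; have := leq_mul lt (leqnn L); rewrite mulSn; lia.
have /fin_all_exists[f hf] b : exists f : seq I * nat,
   [/\ uniq f.1, {subset f.1 <= blk b}, size f.1 = 2 ^ k,
      (forall i, i \in f.1 -> f.2 %| F i) & B <= f.2 ^ D'].
  have [||i ib|r' [q h]] := IH (blk b) F B B0.
  - by rewrite take_uniq ?drop_uniq.
  - by rewrite blk_size.
  - exact/hF/(blk_sub b).
  by exists (r', q).
have [||b [b' [_ _ nb hB]]] :=
  exists_large_gcd_pair (F := fun b => (f b).2) B0 D'0 (enum_uniq 'I_(2 * D')).
- by rewrite size_enum_ord.
- move=> b _; have [_ sb sz hq ->] := hf b; split=> //.
  case E: (f b).1 sz hq sb => [|i t]; first by move/esym/eqP; rewrite expn_eq0.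
  move=> _ hq sb; apply: dvdn_trans (hq i (mem_head _ _)) _.
  by case: (hF i (blk_sub b _ (sb _ (mem_head _ _)))).
have [u1 s1 z1 q1 _] := hf b; have [u2 s2 z2 q2 _] := hf b'.
exists ((f b).1 ++ (f b').1), (gcdn (f b).2 (f b').2); split=> //.
- rewrite cat_uniq u1 u2 andbT; apply/hasPn => x /s2 xb'; apply/negP => /s1 xb.
  by case/negP: nb; apply/eqP/(blk_disj _ _ _ xb xb').
- by move=> x; rewrite mem_cat => /orP[/s1|/s2]; apply: blk_sub.
- by rewrite size_cat z1 z2 expnS mul2n addnn.
move=> i; rewrite mem_cat => /orP[/q1|/q2]; apply: dvdn_trans.
  exact: dvdn_gcdl.
exact: dvdn_gcdr.
Qed.

(** * Counting tuples with one constrained coordinate *)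

(** Overwriting coordinate [j] by [w0] leaves at most [#|D| ^ #|I|.-1] images, and each fibre embeds
    in a single set [S f0] through the value at [j]. *)
Lemma card_ffun_coord_leq (I W : finType) (w0 : W) (j : I) (D : {set W})
    (S : {ffun I -> W} -> {set W}) (L : nat) :
  (forall f g : {ffun I -> W}, (forall i, i != j -> f i = g i) -> S f = S g) ->
  (forall f : {ffun I -> W}, (forall i, f i \in D) -> #|S f| <= L) ->
  #|[set f : {ffun I -> W} | [forall i, f i \in D] && (f j \in S f)]|
    <= L * #|D| ^ #|I|.-1.
Proof.
move=> S_local S_le; set X := [set f | _].
pose e (f : {ffun I -> W}) := [ffun i => if i == j then w0 else f i].
have le_im : #|e @: X| <= #|D| ^ #|I|.-1.
  have -> : #|I|.-1 = #|predC1 j| by rewrite -(cardC1 j).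
  rewrite -(card_pffun_on w0 (predC1 j) (mem D)); apply/subset_leq_card/fintype.subsetP => g.
  case/finset.imsetP=> f; rewrite inE => /andP[/forallP fD _] ->.
  apply/pfamilyP; split=> [|i]; last by rewrite inE ffunE => /negPf ->.
  by apply/supportP => i; rewrite inE negbK ffunE => /eqP ->; rewrite eqxx.
apply: leq_trans (leq_mul (leqnn L) le_im).
rewrite -sum1_card (partition_big e (mem (e @: X))) => [|f fX]; last exact: imset_f.
rewrite mulnC -sum_nat_const; apply: leq_sum => _ /finset.imsetP[f0 f0X ->].
have /forallP f0D : [forall i, f0 i \in D] by move: f0X; rewrite inE => /andP[].
apply: leq_trans (S_le f0 f0D); rewrite sum1_card.
have e_eq f : e f == e f0 -> forall i, i != j -> f i = f0 i.
  by move=> /eqP/ffunP ee i /negPf nij; have := ee i; rewrite !ffunE nij.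
rewrite -(card_in_imset (f := fun f : {ffun I -> W} => f j)).
  apply/subset_leq_card/fintype.subsetP => _ /finset.imsetP[f fP ->].
  move: fP; rewrite unfold_in => /andP[]; rewrite inE => /andP[_ fS] /e_eq ee.
  by rewrite -(S_local f f0).
move=> f g; rewrite !unfold_in => /andP[_ /e_eq ef] /andP[_ /e_eq eg] fg.
by apply/ffunP => i; have [->//|nij] := eqVneq i j; rewrite ef ?eg.
Qed.


Local Open Scope ring_scope.

(** * Multiplicative relations as divisibilities *)

(** Multiplying the relation by all [a j ^ K], where [K = k i], makes every exponent nonnegative and
    that of [a i] equal to [2 * K]. Cancelling [a i ^ K] leaves a divisibility of [K]-th powers. *)
Lemma prod_exprz_eq1_dvdn_max (F : numFieldType) (s : nat) (a k : 'I_s -> int) i :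
  (forall j, a j != 0) -> 0 < k i -> (forall j, `|k j| <= k i) ->
  \prod_(j < s) ((a j)%:~R : F) ^ k j = 1 ->
  (`|a i| %| \prod_(j < s | j != i) `|a j|)%N.
Proof.
move=> a0 ki0 maxk prod1.
pose K := `|k i|%N; have kiE : k i = K by rewrite /K gez0_abs // ltW.
pose e j := absz (k j + K%:Z).
have eE j : k j + K%:Z = e j.
  by rewrite /e gez0_abs // -kiE -lerBlDr sub0r lerNl (le_trans _ (maxk j)) // -normrN ler_norm.
have : \prod_(j < s) a j ^+ e j = \prod_(j < s) a j ^+ K.
  apply: (@intr_inj F); rewrite !rmorph_prod /=.
  rewrite -[RHS]mul1r -[X in _ = X * _]prod1 -big_split /=; apply: eq_bigr => j _.
  by rewrite !rmorphXn /= -[RHS]/(_ * (a j)%:~R ^ K%:Z) -expfzDr ?intr_eq0 // eE.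
move/(congr1 absz); rewrite !(big_morph absz abszM (erefl : `|1|%N = 1%N)).
rewrite !(eq_bigr _ (fun j _ => abszX _ _)) (bigD1 i) //= [RHS](bigD1 i) //=.
have -> : e i = (K + K)%N by apply/eqP; rewrite -eqz_nat -eE kiE.
rewrite expnD -mulnA => /eqP; rewrite eqn_pmul2l ?expn_gt0 ?absz_gt0 ?a0 // => /eqP h.
have K0 : (0 < K)%N by rewrite absz_gt0 gt_eqF.
rewrite -(dvdn_pexp2r _ _ K0).
rewrite (big_morph (expn^~ K) (fun x y => expnMn x y K) (exp1n K)) -h.
exact: dvdn_mulr.
Qed.

Lemma prod_exprz_eq1_dvdn (F : numFieldType) (s : nat) (a k : 'I_s -> int) :
  (forall i, a i != 0) -> (exists i, k i != 0) ->
  \prod_(i < s) ((a i)%:~R : F) ^ k i = 1 ->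
  exists i, (`|a i| %| \prod_(j < s | j != i) `|a j|)%N.
Proof.
move=> a0 [i0 ki0] prod1.
pose i := [arg max_(i > i0) `|k i|]%O.
have maxk j : `|k j| <= `|k i| by rewrite /i; case: arg_maxP => // m _ hm; apply: hm.
have ki : k i != 0 by rewrite -normr_gt0 (lt_le_trans _ (maxk i0)) ?normr_gt0.
exists i; have [k_ge0|k_lt0] := leP 0 (k i).
  apply: prod_exprz_eq1_dvdn_max prod1 => // [|j]; first by rewrite lt0r ki.
  by rewrite (le_trans (maxk j)) // ger0_norm.
apply: (@prod_exprz_eq1_dvdn_max F s a (fun j => - k j)) => // [|j|].
- by rewrite oppr_gt0.
- by rewrite normrN (le_trans (maxk j)) // ltr0_norm.
rewrite (eq_bigr (fun j => ((a j)%:~R ^ k j)^-1)) => [|j _]; last by rewrite invr_expz.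
by rewrite prodfV prod1 invr1.
Qed.

(** * Zeros of recurrence sequences *)

Lemma all_root_factor (R : idomainType) (P : {poly R}) (t : seq R) :
  uniq t -> all (root P) t -> exists Q, P = Q * \prod_(x <- t) ('X - x%:P).
Proof.
elim: t P => [|x t IH] P /=; first by exists P; rewrite big_nil mulr1.
case/andP=> xt ut /andP[/factor_theorem[Q ->] rt].
have [|Q' ->] := IH Q ut; last by exists Q'; rewrite big_cons -mulrA [X in _ * X]mulrC.
apply/allP => y yt; move/allP: rt => /(_ y yt); rewrite rootM root_XsubC.
by case/orP=> // /eqP yx; rewrite -yx yt in xt.
Qed.

Definition ffact_poly (R : nzRingType) (k : nat) : {poly R} :=
  \prod_(i < k) ('X - i%:R%:P).

Lemma monic_ffact_poly (R : nzRingType) k : ffact_poly R k \is monic.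
Proof. exact: monic_prod_XsubC. Qed.

Lemma size_ffact_poly (R : nzRingType) k : size (ffact_poly R k) = k.+1.
Proof. by rewrite /ffact_poly size_prod_XsubC /index_enum -enumT size_enum_ord. Qed.

Lemma map_ffact_poly (R S : nzRingType) (f : {rmorphism R -> S}) k :
  map_poly f (ffact_poly R k) = ffact_poly S k.
Proof.
rewrite rmorph_prod; apply: eq_bigr => i _.
by rewrite rmorphB /= map_polyX map_polyC /= rmorph_nat.
Qed.

Lemma horner_ffact_poly (R : comNzRingType) k (n : nat) :
  (ffact_poly R k).[n%:R] = (n ^_ k)%:R.
Proof.
elim: k => [|k IH]; first by rewrite /ffact_poly big_ord0 hornerC ffactn0.
rewrite /ffact_poly big_ord_recr /= hornerM -/(ffact_poly R k) IH ffactnSr natrM hornerXsubC.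
have [le_kn|lt_nk] := leqP k n; first by rewrite natrB.
by rewrite ffact_small // !mul0r.
Qed.

Lemma ffact_poly_free (R : idomainType) (b : nat -> R) n :
  \sum_(k < n) b k *: ffact_poly R k = 0 -> forall k, (k < n)%N -> b k = 0.
Proof.
elim: n => // n IH; rewrite big_ord_recr /= => h k.
have bn0 : b n = 0.
  move/(congr1 (fun P : {poly R} => P`_n)): h; rewrite coefD coefZ coef0.
  have := monic_ffact_poly R n; rewrite monicE /lead_coef size_ffact_poly /= => /eqP ->.
  rewrite coef_sum big1 => [|i _]; first by rewrite add0r mulr1.
  by rewrite coefZ nth_default ?mulr0 // size_ffact_poly.
rewrite ltnS leq_eqVlt => /orP[/eqP -> //|]; apply: IH.
by move: h; rewrite bn0 scale0r addr0.
Qed.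

(** Distinct integer roots may collide modulo [p], so they are factored out over the integers before
    reducing: a product of more than [K] monic linear factors cannot divide a nonzero polynomial of
    degree at most [K]. *)
Lemma ffact_coef_dvdz (p : nat) (b : nat -> int) (n K : nat) (t : seq int) :
  prime p -> uniq t -> (K < size t)%N ->
  all (root (\sum_(k < n) b k *: ffact_poly int k)) t ->
  (forall k, (K < k)%N -> (p %| b k)%Z) ->
  forall k, (k < n)%N -> (p %| b k)%Z.
Proof.
move=> pp ut st rt hK.
have pF k : (p %| b k)%Z = ((b k)%:~R == 0 :> 'F_p) by exact/dvdz_pcharf/pchar_Fp.
have [Q PQ] := all_root_factor ut rt.
pose f : {rmorphism int -> 'F_p} := intr.
have mapP : \sum_(k < n) f (b k) *: ffact_poly 'F_p k =
    map_poly f Q * \prod_(x <- t) ('X - (f x)%:P).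
  move/(congr1 (map_poly f)): PQ; rewrite rmorph_sum rmorphM rmorph_prod /= => PQ.
  rewrite (eq_bigr (fun x => map_poly f ('X - x%:P))) => [|x _]; last first.
    by rewrite rmorphB /= map_polyX map_polyC.
  by rewrite -PQ; apply: eq_bigr => k _; rewrite map_polyZ map_ffact_poly.
have Q0 : map_poly f Q = 0.
  apply/eqP; apply: contraLR st => Q0; rewrite -leqNgt.
  have := congr1 (size : {poly 'F_p} -> nat) mapP.
  rewrite size_Mmonic ?monic_prod_XsubC //.
  have -> : size (\prod_(x <- t) ('X - (f x)%:P)) = (size t).+1.
    by rewrite -(big_map f xpredT (fun x => 'X - x%:P)) size_prod_XsubC size_map.
  rewrite addnS /= => sz; have Q1 : (0 < size (map_poly f Q))%N by rewrite size_poly_gt0.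
  have : (size (\sum_(k < n) f (b k) *: ffact_poly 'F_p k)%R <= K.+1)%N.
    apply: leq_trans (size_sum _ _ _) _; apply/bigmax_leqP => k _; have [lt_Kk|le_kK] := ltnP K k.
      by move/hK: lt_Kk; rewrite pF => /eqP bk0; rewrite [f _]bk0 scale0r size_poly0.
    by apply: leq_trans (size_scale_leq _ _) _; rewrite size_ffact_poly.
  by rewrite sz => h; rewrite -ltnS (leq_trans _ h) // -add1n leq_add2r.
move: mapP; rewrite Q0 mul0r => /(ffact_poly_free (b := fun k => f (b k))) h k /h h0.
by rewrite pF; apply/eqP.
Qed.

(** Divide all coefficients by [p] and repeat; the roots stay the same and the tail condition loses
    one power of [p]. *)
Lemma ffact_coef_dvdz_exp (p : nat) (n K : nat) (t : seq int) w (b : nat -> int) :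
  prime p -> uniq t -> (K < size t)%N ->
  all (root (\sum_(k < n) b k *: ffact_poly int k)) t ->
  (forall k, (K < k)%N -> (p%:Z ^+ w %| b k)%Z) ->
  forall k, (k < n)%N -> (p%:Z ^+ w %| b k)%Z.
Proof.
move=> pp ut st; elim: w b => [|w IH] b rt hK k kn; first by rewrite expr0 dvd1z.
have p0 : p%:Z != 0 by rewrite eqz_nat -lt0n prime_gt0.
have hp j : (j < n)%N -> (p %| b j)%Z.
  apply: ffact_coef_dvdz pp ut st rt _ j => j /hK; apply: dvdz_trans.
  by rewrite exprS dvdz_mulr.
pose b' j := if (j < n)%N then (b j %/ p)%Z else 0.
have bE j : (j < n)%N -> b j = p%:Z * b' j by move=> jn; rewrite /b' jn mulrC divzK ?hp.
have b'D j : (j < n)%N -> (p%:Z ^+ w.+1 %| b j)%Z = (p%:Z ^+ w %| b' j)%Z.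
  by move=> jn; rewrite bE // exprS dvdz_mul2l.
rewrite b'D //.
apply: IH => // [|j Kj].
  apply/allP => x /(allP rt); rewrite !rootE => r0.
  have: p%:Z * (\sum_(k0 < n) b' k0 *: ffact_poly int k0).[x] == 0.
    rewrite -hornerZ scaler_sumr (eq_bigr (fun j : 'I_n => b j *: ffact_poly int j)) // => j _.
    by rewrite scalerA -bE.
  by rewrite mulf_eq0 (negPf p0).
have [jn|jn] := ltnP j n; last by rewrite /b' ltnNge jn dvdz0.
by rewrite -b'D ?hK.
Qed.

Lemma logn_fact_leq p k : prime p -> (2 < p)%N -> (2 * logn p k`! <= k)%N.
Proof.
move=> pp p3; rewrite logn_fact //.
(* The extra term carries the induction: [q = k %/ p ^ m] satisfies [3 * (q %/ p) <= q], which pays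
   for [2 * (q %/ p)] and the next extra term. *)
suff H m : (2 * (\sum_(1 <= j < m.+1) k %/ p ^ j) + k %/ p ^ m <= k)%N.
  by apply: leq_trans (H k); rewrite leq_addr.
elim: m => [|m IH]; first by rewrite big_geq // expn0 divn1.
rewrite big_nat_recr //=; apply: leq_trans IH.
rewrite expnSr divnMA; set q := (k %/ p ^ m)%N.
have : (q %/ p * 3 <= q)%N by apply: leq_trans (leq_trunc_div q p); rewrite leq_mul2l p3 orbT.
lia.
Qed.

(* Strassmann's bound on the number of zeros of [x |-> \sum_k 'C(x, k) p^k s_k]: the
   coefficient [p^k s_k / k!] of the falling factorial has valuation at least [k / 2]. *)
Lemma binomial_series_zeros (p d : nat) (s : nat -> int) (t : seq nat) :
  prime p -> (2 < p)%N -> uniq t -> (2 * d < size t)%N ->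
  (forall m, m \in t -> \sum_(k < m.+1) 'C(m, k)%:Z * p%:Z ^+ k * s k = 0) ->
  (forall v, (forall k, (k < d)%N -> (p%:Z ^+ v %| s k)%Z) ->
     forall k, (p%:Z ^+ v %| s k)%Z) ->
  forall k, (k < d)%N -> s k = 0.
Proof.
move=> pp p2 ut st zt propag.
have pE e : p%:Z ^+ e = (p ^ e)%N by rewrite -[RHS]natz natrX natz.
(* An integer divisible by every power of [p] is zero. *)
suff H v k : (k < d)%N -> (p%:Z ^+ v %| s k)%Z.
  move=> k kd; apply/eqP; rewrite -absz_eq0; apply: contraTT (H `|s k|%N k kd) => sk.
  by rewrite dvdzE abszX /= gtnNdvd ?lt0n // ltn_expl ?prime_gt1.
elim: v k => [|v IH] k kd; first by rewrite expr0 dvd1z.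
(* [n] exceeds every element of [t], so truncating at [n] loses no term of the series at these
   points. *)
pose n := (d + \max_(m <- t) m.+1)%N.
have tn m : m \in t -> (m < n)%N.
  move=> mt; apply: leq_trans (leq_addl _ _).
  by rewrite (big_rem m) //= leq_maxl.
pose c j := (\prod_(j.+1 <= i < n.+1) i)%N.
have cE j : (j < n)%N -> n`! = (j`! * c j)%N by move/ltnW=> jn; exact: fact_split.
have c0 j : (0 < c j)%N.
  by rewrite /c big_nat_cond; apply: prodn_cond_gt0 => i; rewrite andbT; case: i.
(* As [c j] is the quotient of the factorials of [n] and [j], this is the falling factorial
   coefficient cleared of denominators. *)
pose b j := if (j < n)%N then (c j)%:Z * p%:Z ^+ j * s j else 0.
pose a := logn p n`!.
have ac j : (j < n)%N -> a = (logn p j`! + logn p (c j))%N.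
  by move=> jn; rewrite /a (cE j jn) lognM ?fact_gt0.
(* The valuation of [b j] is at least [a + j + v] minus that of the factorial of [j], which is at
   most [j / 2]; and [j > 2 * d]. *)
have hb j : (2 * d < j)%N -> (p%:Z ^+ (a + v + d) %| b j)%Z.
  rewrite /b; case: ifP => [jn dj|_ _]; last by rewrite dvdz0.
  rewrite (pE (a + v + d)%N).
  have le : (a + v + d <= logn p (c j) + j + v)%N.
    by rewrite (ac j jn); have := logn_fact_leq j pp p2; lia.
  apply: (@dvdz_trans (p ^ (logn p (c j) + j + v))%N); first by rewrite dvdzE /= dvdn_exp2l.
  rewrite !expnD !PoszM; apply: dvdz_mul; last by rewrite -pE; apply: propag.
  by rewrite -(pE j); apply: dvdz_mul => //; apply: pfactor_dvdnn.
have rt : all (root (\sum_(j < n) b j *: ffact_poly int j)) (map Posz t).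
  apply/allP => _ /mapP[m mt ->]; rewrite rootE horner_sum.
  have mn := tn m mt.
  transitivity (n`!%:Z * \sum_(j < m.+1) 'C(m, j)%:Z * p%:Z ^+ j * s j == 0); last first.
    by rewrite zt // mulr0.
  rewrite (big_ord_widen n (fun j => 'C(m, j)%:Z * p%:Z ^+ j * s j) mn) mulr_sumr.
  congr (_ == 0); rewrite [RHS]big_mkcond /=; apply: eq_bigr => j _.
  rewrite hornerZ -[m%:Z]natz horner_ffact_poly /b ltn_ord.
  rewrite natz; case: ltnP => [jm|mj]; last by rewrite ffact_small // mulr0.
  by rewrite -bin_ffact (cE j) // !PoszM; ring.
have := ffact_coef_dvdz_exp pp _ _ rt hb _; rewrite map_inj_uniq ?size_map //;
  last by move=> x y [].
have kn : (k < n)%N by rewrite /n ltn_addr.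
move=> /(_ ut st k kn); rewrite /b kn.
have [->|sk0] := eqVneq (s k) 0; first by rewrite dvdz0.
(* For [k < d] the exponent [a + v + d] exceeds the valuation of [c k * p ^ k] by at least [v + 1],
   so one more power of [p] divides [s k]. *)
rewrite !pE !dvdzE !abszM /= pfactor_dvdn ?muln_gt0 ?c0 ?expn_gt0 ?absz_gt0 ?sk0 ?prime_gt0 //.
rewrite !lognM ?muln_gt0 ?c0 ?expn_gt0 ?absz_gt0 ?sk0 ?prime_gt0 // pfactorK //.
by rewrite pfactor_dvdn ?absz_gt0 // (ac k kn); lia.
Qed.

(** Modulo [p] the matrix is invertible, and [T] is its order in the finite group of units. *)
Lemma exp_mx_congr1 (n : nat) (A : 'M[int]_n.+1) (p : nat) :
  prime p -> ~~ (p %| \det A)%Z ->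
  exists T B, (0 < T)%N /\ A ^+ T = 1 + p%:Z *: B.
Proof.
move=> pp pA; pose f : {rmorphism int -> 'F_p} := intr.
have fE (x : int) : (p %| x)%Z = (f x == 0) by exact/dvdz_pcharf/pchar_Fp.
have uA : map_mx f A \is a GRing.unit.
  by rewrite -[_ \is a _]/(_ \in unitmx) unitmxE det_map_mx unitfE -fE.
pose a := FinRing.unit 'M['F_p]_n.+1 uA.
exists #[a]%g, (\matrix_(i, j) ((A ^+ #[a]%g - 1) i j %/ p)%Z).
split; first exact: order_gt0.
have fA : map_mx f (A ^+ #[a]%g) = 1.
  rewrite rmorphXn /= -[map_mx f A]/(val a) -FinRing.val_unitX expg_order; exact: FinRing.val_unit1.
rewrite -[LHS](subrKC 1); congr (_ + _); apply/matrixP => i j.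
rewrite [RHS]mxE [X in _ = _ * X]mxE mulrC divzK // fE.
have := congr1 (fun M : 'M['F_p]_n.+1 => M i j) fA; rewrite !mxE rmorphB /= => ->.
by rewrite rmorph_nat subrr.
Qed.

(** By Cayley-Hamilton these entries satisfy a monic integer recurrence of order [n.+1], so
    divisibility passes from the first terms to all. The case [q = 0] transports vanishing. *)
Lemma dvdz_exp_mx_entry (n : nat) (B : 'M[int]_n.+1) (e : 'rV[int]_n.+1)
    (W : 'cV[int]_n.+1) (q : int) :
  (forall k, (k < n.+1)%N -> (q %| ((e *m B ^+ k *m W) 0 0)%R)%Z) ->
  forall k, (q %| ((e *m B ^+ k *m W) 0 0)%R)%Z.
Proof.
move=> hq k; elim/ltn_ind: k => k IH; have [/hq//|le_nk] := ltnP k n.+1.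
have := Cayley_Hamilton B; set P := char_poly B.
have -> : P = 'X^(n.+1) + \sum_(i < n.+1) P`_i *: 'X^i.
  rewrite -poly_def; apply/polyP => i; rewrite coefD coefXn coef_poly.
  case: (ltngtP i n.+1) => [lt|gt|->]; rewrite ?add0r // ?addr0.
    by rewrite nth_default // size_char_poly.
  by have := char_poly_monic B; rewrite monicE /lead_coef size_char_poly => /eqP.
rewrite rmorphD rmorphXn /= horner_mx_X rmorph_sum /= => /eqP.
rewrite addr_eq0 => /eqP BE.
rewrite -(subnK le_nk) exprD BE mulrN mulr_sumr mulmxN mulNmx mxE rpredN.
rewrite mulmx_sumr mulmx_suml summxE; apply: rpred_sum => i _.
rewrite linearZ /= rmorphXn /= horner_mx_X -scalerAr -exprD -scalemxAr -scalemxAl mxE.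
by apply/dvdz_mull/IH; have := ltn_ord i; lia.
Qed.

(* The hypothesis [A_free] is the form in which nondegeneracy enters. *)
Lemma exp_mx_entry_zeros (n : nat) (A : 'M[int]_n.+1) :
  \det A != 0 ->
  (forall T (W : 'cV[int]_n.+1), (0 < T)%N ->
     (forall t, (A ^+ (T * t) *m W) 0 0 = 0) -> W = 0) ->
  exists K, forall (H : seq nat) (W : 'cV[int]_n.+1), uniq H -> (K <= size H)%N ->
    (forall h, h \in H -> (A ^+ h *m W) 0 0 = 0) -> W = 0.
Proof.
move=> detA A_free.
(* Large enough to be odd and prime to the determinant. *)
have [p p_gt pp] := prime_above (2 + `|\det A|).
have pA : ~~ (p %| \det A)%Z.
  by rewrite dvdzE /= gtnNdvd ?absz_gt0 // (leq_ltn_trans _ p_gt) // leq_addl.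
have p2 : (2 < p)%N by rewrite (leq_ltn_trans _ p_gt) // leq_addr.
have [T [B [T0 AT]]] := exp_mx_congr1 pp pA.
(* By pigeonhole some class modulo [T] holds more than [2 * n.+1] elements of [H], as Strassmann's
   bound requires. *)
exists (T * (2 * n.+1)).+1 => H W uH sH zH.
pose Hr r := [seq h <- H | h %% T == r]%N.
have sum_r : (size H = \sum_(r < T) size (Hr r))%N.
  rewrite {uH sH zH}/Hr; elim: (H) => [|h H' IH] /=; first by rewrite big1.
  rewrite (eq_bigr (fun r : 'I_T => (h %% T == r) + size [seq h0 <- H' | h0 %% T == r])%N).
    rewrite big_split /= -IH (bigD1 (Ordinal (ltn_pmod h T0))) //= eqxx big1 // => i.
    by rewrite -val_eqE /= eq_sym => /negPf ->.
  by move=> i _; case: (h %% T =P i)%N.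
have [r rT sr] : exists2 r, (r < T)%N & (2 * n.+1 < size (Hr r))%N.
  have [/hasP[r]|/hasPn no] := boolP (has (fun r => 2 * n.+1 < size (Hr r))%N (iota 0 T)).
    by rewrite mem_iota add0n => rT sr; exists r.
  move: sH; rewrite sum_r ltnNge => /negP[]; rewrite -[T in (_ <= T * _)%N]card_ord -sum_nat_const.
  by apply: leq_sum => i _; rewrite leqNgt no // mem_iota ltn_ord.
pose Wr := A ^+ r *m W; pose e : 'rV[int]_n.+1 := delta_mx 0 0.
have entry (M : 'M[int]_n.+1) (V : 'cV[int]_n.+1) : (M *m V) 0 0 = (e *m M *m V) 0 0.
  by rewrite -mulmxA -rowE [RHS]mxE.
pose s k := (e *m B ^+ k *m Wr) 0 0.
have AW m : (A ^+ (T * m) *m Wr) 0 0 = \sum_(k < m.+1) 'C(m, k)%:Z * p%:Z ^+ k * s k.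
  rewrite entry exprM AT exprDn_comm; last by apply: commr_sym; apply: commr1.
  rewrite mulmx_sumr mulmx_suml summxE; apply: eq_bigr => k _.
  rewrite expr1n mul1r -scaler_nat exprZn scalerA -scalemxAr -scalemxAl mxE natz.
  by [].
have s0 : forall k, (k < n.+1)%N -> s k = 0.
  apply: (@binomial_series_zeros p n.+1 s [seq h %/ T | h <- Hr r]%N) => //.
  - rewrite map_inj_in_uniq ?filter_uniq // => x y; rewrite !mem_filter.
    move=> /andP[/eqP xr _] /andP[/eqP yr _] xy.
    by rewrite (divn_eq x T) (divn_eq y T) xr yr xy.
  - by rewrite size_map.
  - move=> _ /mapP[h + ->]; rewrite mem_filter => /andP[/eqP hr hH].
    rewrite -AW /Wr mulmxA -[A ^+ _ *m A ^+ _]/(A ^+ _ * A ^+ _) -exprD.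
    by rewrite mulnC -hr -divn_eq zH.
  - by move=> v; apply: dvdz_exp_mx_entry.
have s0' k : s k = 0.
  apply/eqP; rewrite -dvd0z; apply: dvdz_exp_mx_entry => j jn; rewrite dvd0z; exact/eqP/s0.
have : Wr = 0.
  apply: (A_free T Wr T0) => t; rewrite AW big1 // => k _; by rewrite s0' mulr0.
move=> /(congr1 (mulmx (\adj (A ^+ r)))); rewrite /Wr mulmxA mul_adj_mx mulmx0 mul_scalar_mx.
have -> : \det (A ^+ r) = \det A ^+ r.
  elim: r {rT sr Wr s AW s0 s0'} => [|r IH]; first by rewrite !expr0 det1.
  by rewrite !exprS det_mulmx IH.
by move/eqP; rewrite scalemx_eq0 expf_eq0 (negPf detA) andbF => /eqP.
Qed.

(** * Minors and common divisors *)

(* Working with the Gram matrix [M^T M] produces an integral kernel vector directly. *)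
Lemma ker0_minor_neq0 (m n : nat) (M : 'M[int]_(m, n)) :
  (forall W : 'cV[int]_n, M *m W = 0 -> W = 0) ->
  exists f : 'I_n -> 'I_m, \det (rowsub f M) != 0.
Proof.
move=> kerM; pose Q := map_mx (intr : int -> rat).
have detG : \det (M^T *m M) != 0.
  apply/negP => /det0P[v v0 vG]; case/negP: v0.
  suff : M *m v^T = 0 by move/kerM/(congr1 trmx); rewrite trmxK trmx0 => ->.
  (* The sum of squares of the entries of [M *m v^T] is the Gram form evaluated at [v], hence
     zero. *)
  have sq0 : \sum_j ((M *m v^T) j 0) ^+ 2 = 0.
    have : (v *m (M^T *m M) *m v^T) 0 0 = 0 by rewrite vG mul0mx mxE.
    have aE : v *m M^T = (M *m v^T)^T by rewrite trmx_mul trmxK.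
    rewrite mulmxA aE -mulmxA mxE => vGv; rewrite -[RHS]vGv.
    by apply: eq_bigr => j _; rewrite [X in _ = X * _]mxE expr2.
  apply/colP => j; rewrite [RHS]mxE; apply/eqP; rewrite -sqrf_eq0.
  have /psumr_eq0P h : forall i, true -> 0 <= ((M *m v^T) i 0) ^+ 2 by move=> i _; rewrite sqr_ge0.
  by rewrite h.
have fullM : row_full (Q _ _ M).
  have : row_full (Q _ _ M^T *m Q _ _ M).
    by rewrite row_full_unit -map_mxM unitmxE det_map_mx unitfE intr_eq0.
  rewrite -!col_leq_rank => h; exact: leq_trans h (mxrankM_maxr _ _).
exists (fullrankfun fullM); rewrite -(intr_eq0 rat) -det_map_mx map_mxsub.
by have := fullrowsub_unit fullM; rewrite unitmxE unitfE.
Qed.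

Lemma absz_det_leq (n : nat) (M : 'M[int]_n) (c : nat) :
  (forall i j, (`|M i j| <= c)%N) -> (`|\det M| <= n`! * c ^ n)%N.
Proof.
move=> hM; rewrite -lez_nat abszE.
apply: le_trans (ler_norm_sum _ _ _) _.
have -> : (n`! * c ^ n)%N%:Z = \sum_(s : 'S_n) (c ^ n)%N%:Z.
  by rewrite sumr_const card_Sn -mulr_natl natz PoszM.
apply: ler_sum => s _; rewrite normrM normrX normrN1 expr1n mul1r normr_prod.
rewrite -[(c ^ n)%N%:Z]natz natrX natz -[n in _ ^+ n]card_ord -prodr_const.
by apply: ler_prod => i _; rewrite normr_ge0 /= -abszE lez_nat.
Qed.

Lemma absz_exp_mx_entry_leq (n : nat) (A : 'M[int]_n.+1) :
  exists2 C, (0 < C)%N & forall h i j, (`|(A ^+ h)%R i j| <= C ^ h)%N.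
Proof.
pose c := (\max_i \max_j `|A i j|)%N.
have cA i j : (`|A i j| <= c)%N.
  by apply: leq_trans (leq_bigmax i); apply: (leq_bigmax (F := fun j => `|A i j|%N)).
exists (n.+1 * c.+1)%N => // h; elim: h => [|h IH] i j.
  by rewrite expr0 mxE; case: eqP.
rewrite exprS mxE.
have : `|\sum_k A i k * (A ^+ h) k j| <= \sum_(k < n.+1) ((c.+1 * (n.+1 * c.+1) ^ h)%N%:Z).
  apply: le_trans (ler_norm_sum _ _ _) (ler_sum _ _) => k _.
  rewrite normrM PoszM -!abszE; apply: ler_pM => //; rewrite lez_nat //.
  by apply: leq_trans (cA i k) _.
rewrite sumr_const card_ord -mulr_natl natz -PoszM -abszE lez_nat => h1.
by apply: leq_trans h1 _; rewrite expnS mulnA.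
Qed.

(** The adjugate turns [M *m W] into [\det M] times [W], so [q * g] divides [\det M] times each
    entry, hence [\det M * g], and [g] cancels. *)
Lemma dvdn_biggcd_leq (n : nat) (M : 'M[int]_n.+1) (W : 'cV[int]_n.+1) (q g : nat) :
  \det M != 0 -> g = \big[gcdn/0%N]_i `|(W i 0)%R|%N -> (0 < g)%N ->
  (forall i, (q * g %| `|((M *m W) i 0)%R|)%N) ->
  (q <= `|\det M|)%N.
Proof.
move=> detM gE g0 hq; apply: dvdn_leq; first by rewrite absz_gt0.
rewrite -(dvdn_pmul2r g0) gE (big_morph (muln `|\det M|) (muln_gcdr _) (muln0 _)) -gE.
elim/big_ind: _ => [|x y hx hy|i _]; rewrite ?dvdn0 // ?dvdn_gcd ?hx //.
have : \det M * W i 0 = (\adj M *m (M *m W)) i 0.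
  by rewrite mulmxA mul_adj_mx mul_scalar_mx mxE.
rewrite -abszM => ->.
rewrite -[(_ %| _)%N]/(dvdz (q * g)%N%:Z ((\adj M *m (M *m W)) i 0)) mxE.
by apply: rpred_sum => k _; apply/dvdz_mull/hq.
Qed.

(** * Companion and Hankel matrices *)

(** Companion matrix with the coefficients in the last row, so that it moves a block of consecutive
    terms one step forward. The order is written [n.+1] because matrices of that size form a
    ring. *)
Definition rec_mx (n : nat) (c : 'I_n.+1 -> int) : 'M[int]_n.+1 :=
  \matrix_(i, j) if i == ord_max then c j else ((j : nat) == i.+1)%:R.

Definition state (n : nat) (u : nat -> int) (k : nat) : 'cV[int]_n :=
  \col_i u (k + i)%N.

Lemma rec_mx_state n (c : 'I_n.+1 -> int) u k : lin_rec_rel u c -> (0 < k)%N ->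
  rec_mx c *m state n.+1 u k = state n.+1 u k.+1.
Proof.
move=> hu k0; apply/colP => i; rewrite !mxE.
have [->|ni] := eqVneq i ord_max.
  rewrite addSnnS hu //; apply: eq_bigr => j _; by rewrite !mxE eqxx.
have lt : (i.+1 < n.+1)%N.
  by rewrite ltn_neqAle -val_eqE in ni *; rewrite ltn_ord andbT.
rewrite (bigD1 (Ordinal lt)) //= !mxE (negPf ni) eqxx mul1r addnS big1 ?addr0 ?addSn // => j nj.
by rewrite !mxE (negPf ni) -[(_ == _)%N]/(j == Ordinal lt) (negPf nj) mul0r.
Qed.

Lemma rec_mx_exp_state n (c : 'I_n.+1 -> int) u h k : lin_rec_rel u c -> (0 < k)%N ->
  rec_mx c ^+ h *m state n.+1 u k = state n.+1 u (k + h).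
Proof.
move=> hu k0; elim: h => [|h IH]; first by rewrite expr0 mul1mx addn0.
by rewrite exprS -mulmxA IH rec_mx_state ?addnS ?addn_gt0 ?k0.
Qed.

(** A polynomial in the companion matrix acts on states as the same polynomial in the shift, so
    annihilating polynomials are linear relations on the sequence. *)
Lemma horner_rec_mx_state n (c : 'I_n.+1 -> int) u (P : {poly int}) m k i :
  lin_rec_rel u c -> (0 < k)%N -> (size P <= m)%N ->
  (horner_mx (rec_mx c) P *m state n.+1 u k) i 0 = \sum_(j < m) P`_j * u (k + i + j)%N.
Proof.
move=> hu k0 sP; rewrite -{1}[P](take_poly_id sP) /take_poly poly_def rmorph_sum mulmx_suml summxE.
apply: eq_bigr => j _.
rewrite -mul_polyC rmorphM rmorphXn /= horner_mx_X horner_mx_C.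
rewrite -mulmxA mul_scalar_mx mxE rec_mx_exp_state // mxE.
by rewrite addnAC.
Qed.

Lemma size_rec_char_poly n (c : 'I_n -> int) : size (rec_char_poly c) = n.+1.
Proof.
rewrite /rec_char_poly size_polyDl size_polyXn // size_polyN.
apply: leq_ltn_trans (size_sum _ _ _) _; rewrite ltnS; apply/bigmax_leqP => i _.
by apply: leq_trans (size_scale_leq _ _) _; rewrite size_polyXn.
Qed.

Lemma coef_rec_char_poly n (c : 'I_n -> int) (i : 'I_n) : (rec_char_poly c)`_i = - c i.
Proof.
rewrite coefB coefXn (ltn_eqF (ltn_ord i)) sub0r coef_sum (bigD1 i) //=.
rewrite coefZ coefXn eqxx mulr1 big1 ?addr0 // => j nj.
by rewrite coefZ coefXn eq_sym -[(_ == _)%N]/(j == i) (negPf nj) mulr0.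
Qed.

Lemma monic_rec_char_poly n (c : 'I_n -> int) : rec_char_poly c \is monic.
Proof.
rewrite monicE /lead_coef size_rec_char_poly /= coefB coefXn eqxx coef_sum big1 ?subr0 // => i _.
by rewrite coefZ coefXn (gtn_eqF (ltn_ord i)) mulr0.
Qed.

Lemma rec_char_poly_state n (c : 'I_n.+1 -> int) u k : lin_rec_rel u c -> (0 < k)%N ->
  horner_mx (rec_mx c) (rec_char_poly c) *m state n.+1 u k = 0.
Proof.
move=> hu k0; apply/colP => i; rewrite (horner_rec_mx_state (m := n.+2)) ?size_rec_char_poly //.
rewrite mxE big_ord_recr /=; have := monic_rec_char_poly c.
rewrite monicE /lead_coef size_rec_char_poly /= => /eqP ->; rewrite mul1r hu ?addn_gt0 ?k0 //.
by rewrite -big_split big1 // => j _; rewrite /= coef_rec_char_poly mulNr addNr.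
Qed.

Definition hankel_mx n (u : nat -> int) : 'M[int]_n := \matrix_(i, j) u (1 + i + j)%N.

(* An integer annihilating polynomial of smallest degree divides the characteristic
   polynomial, so by Gauss's lemma it can be taken monic. *)
Lemma det_hankel_neq0 n (c : 'I_n.+1 -> int) (u : nat -> int) :
  (0 < n)%N -> lin_rec_seq u c -> \det (hankel_mx n.+1 u) != 0.
Proof.
move=> n0 [_ hu umin]; apply/negP => /det0P[v v0 vH].
(* Testing the first state suffices, since powers of the matrix commute with polynomials in it. *)
pose ann (P : {poly int}) := horner_mx (rec_mx c) P *m state n.+1 u 1 == 0.
(* The entries of the kernel vector [v] are the coefficients of an annihilator of size at most
   [n.+1]. *)
have exP : exists m, `[< exists P, [/\ P != 0, ann P, size P = m & (m <= n.+1)%N] >].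
  exists (size (rVpoly v)); apply/asboolP; exists (rVpoly v); rewrite size_poly; split=> //.
    by apply: contraNneq v0 => h; rewrite -[v]rVpolyK h linear0.
  apply/eqP/colP => i; rewrite (horner_rec_mx_state (m := n.+1)) ?size_poly //.
  have /rowP/(_ i) := vH; rewrite !mxE => hv; rewrite -[RHS]hv; apply: eq_bigr => j _.
  by rewrite coef_rVpoly_ord mxE addnAC.
case: (ex_minnP exP) => m /asboolP[Q [Q0 annQ sQ le_m]] minQ.
have W0 : state n.+1 u 1 != 0.
  apply/eqP => W0; apply: (umin 1%N (fun=> 0)) => // k k0.
  have := rec_mx_exp_state k hu (isT : 0 < 1)%N; rewrite W0 mulmx0.
  by move=> /colP/(_ 0); rewrite !mxE addn0 addnC => <-; rewrite big1 // => i _; rewrite mul0r.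
have annD (P P' : {poly int}) : ann P -> ann P' -> ann (P - P').
  by rewrite /ann rmorphB mulmxBl => /eqP -> /eqP ->; rewrite subrr.
have annM (P P' : {poly int}) : ann P' -> ann (P * P').
  by rewrite /ann rmorphM /= -mulmxA => /eqP ->; rewrite mulmx0.
have annf : ann (rec_char_poly c) by apply/eqP/rec_char_poly_state.
have minQ' P : ann P -> (size P < m)%N -> P = 0.
  move=> aP lt; apply/eqP; apply: contraT => P0.
  have : (m <= size P)%N.
    by apply: minQ; apply/asboolP; exists P; split=> //; apply: leq_trans (ltnW lt) le_m.
  by rewrite leqNgt lt.
(* The pseudo-remainder also annihilates and is smaller than [Q], so it vanishes by minimality. *)
have dvQ : Q %| rec_char_poly c.
  apply/eqP/minQ'; last by rewrite -sQ ltn_modpN0.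
  have := Pdiv.Idomain.divp_eq (rec_char_poly c) Q.
  rewrite addrC => /(canLR (addrK _)) <-.
  by apply: annD; [rewrite -mul_polyC|]; apply: annM.
have [r fE] := dvdpP_int dvQ.
have ann_prim : ann (zprimitive Q).
  have := annQ; rewrite {1}[Q]zpolyEprim /ann -mul_polyC rmorphM /= horner_mx_C -mulmxA.
  by rewrite mul_scalar_mx scalemx_eq0 zcontents_eq0 (negPf Q0).
(* The primitive part divides a monic polynomial over the integers, so [l] is [1] or [-1] and [h] is
   monic. *)
pose l := lead_coef (zprimitive Q); pose h := l *: zprimitive Q.
have ann_h : ann h by rewrite /h -mul_polyC; apply: annM.
have l2 : l * l = 1.
  have := monic_rec_char_poly c; rewrite fE monicE lead_coefM -/l => /eqP lr.
  have : (`|l| * `|lead_coef r|)%N == 1%N by rewrite -abszM lr.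
  by rewrite muln_eq1 => /andP[/eqP l1 _]; have [->|->] : l = 1 \/ l = -1 by lia.
have l0 : l != 0 by apply: contra_eq_neq l2 => ->; rewrite mul0r eq_sym oner_eq0.
have sh : size h = m by rewrite size_scale // size_zprimitive.
have lead_h : lead_coef h = 1 by rewrite lead_coefZ.
have [d' mE] : exists d', m = d'.+1.
  by move: Q0; rewrite -size_poly_gt0 sQ; case: (m) => // d'; exists d'.
have d'0 : (0 < d')%N.
  rewrite lt0n; apply: contraNneq W0 => d'0.
  have : h = 1.
    have/size_poly1P[a a0 hE] : size h == 1%N by rewrite sh mE d'0.
    by move: lead_h; rewrite hE lead_coefC => ->.
  by move: ann_h => /[swap] ->; rewrite /ann rmorph1 mul1mx.
apply: (umin d' (fun i => - h`_i)) => //; first by rewrite -ltnS -mE.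
move=> k k0; apply/eqP; rewrite -subr_eq0.
have : (horner_mx (rec_mx c) h *m state n.+1 u k) 0 0 = 0.
  have -> : state n.+1 u k = rec_mx c ^+ k.-1 *m state n.+1 u 1.
    by rewrite rec_mx_exp_state // add1n prednK.
  rewrite -[X in X ^+ _]horner_mx_X.
  rewrite -rmorphXn mulmxA -[_ *m horner_mx _ _]/(_ * _) -rmorphM mulrC /=.
  by have /eqP -> := annM 'X^(k.-1) _ ann_h; rewrite mxE.
rewrite (horner_rec_mx_state (m := d'.+1)) // ?sh ?mE // big_ord_recr /=.
move: lead_h; rewrite /lead_coef sh mE /= => ->; rewrite mul1r addn0 addrC => /eqP.
rewrite -sumrN; congr (_ + _ == 0); apply: eq_bigr => j _; by rewrite mulNr opprK.
Qed.

(** * Eigenvalues of the companion matrix *)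

Section Spectral.
Variables (F : numFieldType) (n : nat) (c : 'I_n.+1 -> int) (l : 'I_n.+1 -> F).
Hypothesis l_inj : injective l.
Hypothesis l_root : forall j, root (map_poly intr (rec_char_poly c)) (l j).

Local Notation A := (rec_mx c).
Local Notation AF := (map_mx (intr : int -> F) A).
Local Notation V := (Vandermonde n.+1 (\row_j l j)).

Lemma Vandermonde_unitmx m (x : 'I_m -> F) :
  injective x -> Vandermonde m (\row_j x j) \in unitmx.
Proof.
move=> x_inj; rewrite unitmxE det_Vandermonde unitfE; apply/prodf_neq0 => i _.
apply/prodf_neq0 => j ij; rewrite !mxE subr_eq0; apply: contraTneq ij => /x_inj ->.
by rewrite ltnn.
Qed.

(** The column of powers of a root is an eigenvector; its last entry is where the characteristic
    equation is used. *)
Lemma rec_mx_Vandermonde : AF *m V = V *m diag_mx (\row_j l j).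
Proof.
apply/matrixP => i j; rewrite mul_mx_diag !mxE -exprSr.
have [->|ni] := eqVneq i ord_max.
  have /rootP := l_root j; rewrite rmorphB /= map_polyXn hornerD hornerN hornerXn.
  move=> /eqP; rewrite subr_eq0 => /eqP ->; rewrite rmorph_sum horner_sum.
  by apply: eq_bigr => k _; rewrite !mxE eqxx /= map_polyZ map_polyXn hornerZ hornerXn.
have lt : (i.+1 < n.+1)%N.
  by rewrite ltn_neqAle -val_eqE in ni *; rewrite ltn_ord andbT.
rewrite (bigD1 (Ordinal lt)) //= !mxE (negPf ni) eqxx mul1r big1 ?addr0 // => k nk.
by rewrite !mxE (negPf ni) -[(_ == _)%N]/(k == Ordinal lt) (negPf nk) mul0r.
Qed.

Lemma det_rec_mx : (\det A)%:~R = \prod_j l j.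
Proof.
have := congr1 determinant rec_mx_Vandermonde.
rewrite !det_mulmx det_diag mulrC => /mulfI; rewrite det_map_mx => -> //.
  by apply: eq_bigr => j _; rewrite mxE.
by have := Vandermonde_unitmx l_inj; rewrite unitmxE unitfE.
Qed.

(** [b] is the coordinate vector of [W] in the Vandermonde eigenbasis. *)
Lemma rec_mx_exp_entry (W : 'cV[int]_n.+1) :
  exists b : 'I_n.+1 -> F, (forall h i,
     ((A ^+ h *m W) i 0)%:~R = \sum_j b j * l j ^+ (h + i)) /\
     ((forall j, b j = 0) -> W = 0).
Proof.
have uV := Vandermonde_unitmx l_inj.
pose WF := map_mx (intr : int -> F) W; pose b := invmx V *m WF.
have WE : WF = V *m b by rewrite mulKVmx.
exists (fun j => b j 0); split=> [h i|b0].
  have AV k : AF ^+ k *m V = V *m diag_mx (\row_j l j ^+ k).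
    elim: k => [|k IH]; first by apply/matrixP => i' j; rewrite expr0 mul1mx mul_mx_diag !mxE mulr1.
    rewrite exprS -mulmxA IH mulmxA rec_mx_Vandermonde -mulmxA; congr (_ *m _).
    rewrite mulmx_diag; congr diag_mx; apply/rowP => j; by rewrite !mxE exprS.
  have -> : ((A ^+ h *m W) i 0)%:~R = (AF ^+ h *m WF) i 0.
    by rewrite -rmorphXn -map_mxM [RHS]mxE.
  rewrite WE mulmxA AV mxE; apply: eq_bigr => j _.
  by rewrite mul_mx_diag !mxE -exprD addnC mulrC.
have : WF = 0 by rewrite WE (_ : b = 0) ?mulmx0 //; apply/colP => j; rewrite b0 mxE.
by move/colP => h; apply/colP => j; have /eqP := h j; rewrite !mxE intr_eq0 => /eqP.
Qed.

(** Sampling at multiples of [T] gives a Vandermonde system in the powers [l j ^+ T], whose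
    distinctness forces all coefficients to vanish. *)
Lemma rec_mx_free T (W : 'cV[int]_n.+1) : (forall i j, l i ^+ T = l j ^+ T -> i = j) ->
  (forall t, (A ^+ (T * t) *m W) 0 0 = 0) -> W = 0.
Proof.
move=> lT_inj hW; have [b [bE b0]] := rec_mx_exp_entry W; apply: b0.
have uV := Vandermonde_unitmx lT_inj.
have : (Vandermonde n.+1 (\row_j l j ^+ T)) *m (\col_j b j) = 0.
  apply/colP => i; rewrite !mxE; have := bE (T * i)%N 0; rewrite hW addn0 => h.
  by rewrite -[RHS]/((0 : int)%:~R) h; apply: eq_bigr => j _; rewrite !mxE -exprM mulrC.
move/(congr1 (mulmx (invmx (Vandermonde n.+1 (\row_j l j ^+ T))))).
by rewrite mulKmx // mulmx0 => /colP h j; have := h j; rewrite !mxE.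
Qed.

(** The Hankel matrix is [V] times the diagonal matrix of the [b j] times [V^T], so a nonzero
    determinant makes every [b j] nonzero. *)
Lemma rec_mx_hankel_coef (u : nat -> int) : lin_rec_rel u c ->
  \det (hankel_mx n.+1 u) != 0 ->
  exists b : 'I_n.+1 -> F, (forall k, (u k.+1)%:~R = \sum_j b j * l j ^+ k) /\
     forall j, b j != 0.
Proof.
move=> hu detH; have [b [bE _]] := rec_mx_exp_entry (state n.+1 u 1).
have uE k (i : 'I_n.+1) : (u (1 + k + i)%N)%:~R = \sum_j b j * l j ^+ (k + i).
  by have := bE k i; rewrite rec_mx_exp_state // mxE.
exists b; split=> [k|j]; first by have := uE k 0; rewrite !addn0 add1n.
have HE : map_mx intr (hankel_mx n.+1 u) = V *m diag_mx (\row_j b j) *m V^T.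
  apply/matrixP => i k; rewrite !mxE uE; apply: eq_bigr => m _.
  by rewrite mul_mx_diag !mxE exprD; ring.
move: detH; rewrite -(intr_eq0 F) -det_map_mx HE !det_mulmx det_diag !mulf_eq0 !negb_or.
by move=> /andP[/andP[_ /prodf_neq0 hb] _]; have := hb j isT; rewrite mxE.
Qed.

End Spectral.

(** * Growth *)

Lemma uniq_prod_XsubC (F : fieldType) (r : seq F) :
  (forall a, ~~ (('X - a%:P) ^+ 2 %| \prod_(z <- r) ('X - z%:P))) -> uniq r.
Proof.
elim: r => [//|z r IH] h /=; rewrite big_cons in h; rewrite IH => [|a]; last first.
  by apply: contra (h a) => d; rewrite dvdp_mull.
rewrite andbT; apply: contra (h z) => zr; rewrite expr2 dvdp_mul //.
by rewrite -root_factor_theorem root_prod_XsubC.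
Qed.

Lemma rec_char_poly_roots (R : realType) (n : nat) (c : 'I_n.+1 -> int) :
  no_multiple_root R (rec_char_poly c) ->
  exists l : 'I_n.+1 -> R[i], [/\ injective l,
    forall j, root (complex_poly R (rec_char_poly c)) (l j) &
    forall a, root (complex_poly R (rec_char_poly c)) a -> exists j, a = l j].
Proof.
move=> simple_c; set p := complex_poly R _ in simple_c *.
have mp : p \is monic by apply/monic_map/monic_rec_char_poly.
have [r pE] := closed_field_poly_normal p; rewrite (monicP mp) scale1r in pE.
have p0 := monic_neq0 mp.
have ur : uniq r.
  apply: uniq_prod_XsubC => a; rewrite -pE -(mup_ltn _ _ p0).
  have [ra|nra] := boolP (root p a); first by rewrite simple_c.
  rewrite (mup_ltn _ _ p0); apply: contra nra => d.
  by rewrite root_factor_theorem; apply: dvdp_trans d; rewrite expr2 dvdp_mulr.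
have sr : size r = n.+1.
  have : size p = n.+2.
    by rewrite size_map_poly_id0 ?size_rec_char_poly //;
      rewrite (monicP (monic_rec_char_poly c)) rmorph1 oner_eq0.
  by rewrite pE size_prod_XsubC => -[].
exists (fun j => r`_j); split=> [i j /eqP|j|a].
- by rewrite nth_uniq ?sr ?ltn_ord // => /eqP/val_inj.
- by rewrite pE root_prod_XsubC mem_nth // sr.
rewrite pE root_prod_XsubC => ar.
have lt : (index a r < n.+1)%N by rewrite -sr index_mem.
by exists (Ordinal lt); rewrite nth_index.
Qed.

Lemma geometric_domination (R : realType) (x y C e : R) :
  0 <= x -> x < y -> 0 < e ->
  exists k0, forall k, (k0 <= k)%N -> C * x ^+ k <= e * y ^+ k.
Proof.
move=> x0 xy e0; have y0 : 0 < y by apply: le_lt_trans xy.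
have xy0 : 0 <= x / y by rewrite divr_ge0 // ltW.
have : `|x / y| < 1 by rewrite ger0_norm // ltr_pdivrMr ?mul1r.
move=> /cvg_expr/cvgrPdist_lt /(_ (e / (`|C| + 1))).
case=> [|k0 _ hk0]; first by rewrite divr_gt0 // ltr_wpDl.
exists k0 => k /hk0 /=; rewrite sub0r normrN ger0_norm ?exprn_ge0 //.
rewrite expr_div_n ltr_pdivrMr ?exprn_gt0 // mulrAC ltr_pdivlMr; last by rewrite ltr_wpDl.
move=> h; apply: le_trans (ltW h); rewrite mulrC ler_wpM2l ?exprn_ge0 //.
by apply: le_trans (ler_norm _) _; rewrite lerDl.
Qed.


Lemma normcX (R : realType) (x : R[i]) k : normc (x ^+ k) = normc x ^+ k.
Proof.
elim: k => [|k IH]; first by rewrite !expr0 normc1.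
by rewrite !exprS normcM IH.
Qed.

Lemma normc_sum (R : realType) (I : Type) (r : seq I) (P : pred I) (f : I -> R[i]) :
  normc (\sum_(i <- r | P i) f i) <= \sum_(i <- r | P i) normc (f i).
Proof.
elim/big_rec2: _ => [|i y x _ h]; first by rewrite normc0.
by apply: le_trans (le_normcD _ _) _; rewrite lerD2l.
Qed.

Lemma normc_prod (R : realType) (I : Type) (r : seq I) (P : pred I) (f : I -> R[i]) :
  normc (\prod_(i <- r | P i) f i) = \prod_(i <- r | P i) normc (f i).
Proof. by rewrite (big_morph (@normc R) (@normcM R) (@normc1 R)). Qed.

Lemma normc_ge0 (R : realType) (x : R[i]) : 0 <= normc x.
Proof. by case: x => a b; exact: sqrtr_ge0. Qed.

Lemma normc_int (R : realType) (m : int) : normc (m%:~R : R[i]) = `|m|%N%:R.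
Proof.
by rewrite -(rmorph_int (real_complex R)) /= expr0n addr0 sqrtr_sqr -intr_norm -abszE -pmulrn.
Qed.

(** Eventually each of the [n.-1] other terms is at most [1 / n.+1] of the dominant one, which
    leaves a share of at least [2 / n.+1]. *)
Lemma dominant_sum_lower_bound (R : realType) (n : nat) (b l : 'I_n -> R[i]) j0 :
  b j0 != 0 -> (forall j, j != j0 -> normc (l j) < normc (l j0)) ->
  exists e k0, 0 < e /\ forall k, (k0 <= k)%N ->
    e * normc (l j0) ^+ k <= normc (\sum_j b j * l j ^+ k).
Proof.
move=> b0 dom; pose B := normc (b j0).
have B0 : 0 < B.
  by rewrite lt_def normc_ge0 andbT; apply: contra_neq b0; apply: eq0_normc.
have e0 : 0 < B / n.+1%:R by rewrite divr_gt0.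
have /fin_all_exists[K hK] j : exists k0, j != j0 -> forall k, (k0 <= k)%N ->
    normc (b j) * normc (l j) ^+ k <= B / n.+1%:R * normc (l j0) ^+ k.
  have [_|/dom lt] := eqVneq j j0; first by exists 0%N.
  have [k0 hk0] := geometric_domination (normc (b j)) (normc_ge0 _) lt e0.
  by exists k0.
exists (B / n.+1%:R), (\max_j K j)%N; split=> // k hk.
have Kk j : (K j <= k)%N by apply: leq_trans hk; apply: leq_bigmax.
pose S := \sum_(j | j != j0) b j * l j ^+ k.
have SB : normc S <= B / n.+1%:R * normc (l j0) ^+ k * n.-1%:R.
  apply: le_trans (normc_sum _ _ _) _.
  rewrite mulr_natr -[n in n.-1]card_ord -(cardC1 j0) -sumr_const; apply: ler_sum => j nj.
  by rewrite normcM normcX; apply: hK.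
rewrite (bigD1 j0) //= -/S.
have : B * normc (l j0) ^+ k <= normc (b j0 * l j0 ^+ k + S) + normc S.
  rewrite -normcX -normcM -[X in normc X <= _](addrK S) -(normcN S); exact: le_normcD.
have -> : B * normc (l j0) ^+ k = B / n.+1%:R * normc (l j0) ^+ k * n.+1%:R.
  by rewrite mulrAC divfK // pnatr_eq0.
have : 0 <= B / n.+1%:R * normc (l j0) ^+ k.
  by rewrite mulr_ge0 ?exprn_ge0 ?normc_ge0 // ltW.
move: SB; set X := B / n.+1%:R * _ => SB X0.
have -> : n.+1%:R = n.-1%:R + 2 :> R.
  by case: (n) j0 {b0 dom B B0 e0 K hK hk Kk S X SB X0} => [[]//|m] _; rewrite -natrD addn2.
rewrite mulrDr; lra.
Qed.

(* [a] stands for the determinant of the recurrence matrix, [D] for the Hankel determinant. *)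
Lemma quotient_growth (R : realType) (d a D k0 : nat) (x e : R) (v : nat -> nat) :
  0 < e -> (0 < a)%N -> (0 < D)%N -> a%:R < x ^+ d -> 1 <= x ->
  (forall k, (k0 <= k)%N -> e * x ^+ k <= (v k)%:R) ->
  exists E M0, forall M k g, (M0 <= M)%N -> (M <= k)%N -> (0 < g)%N ->
     (g ^ d <= D * a ^ M)%N -> (g %| v k)%N -> (2 ^ M <= (v k %/ g) ^ E)%N.
Proof.
move=> e0 a0 D0 ax x1 hv.
have aR : 0 < a%:R :> R by rewrite ltr0n.
have DR : 0 < D%:R :> R by rewrite ltr0n.
pose tau := x ^+ d / a%:R; have tau1 : 1 < tau by rewrite /tau ltr_pdivlMr // mul1r.
pose c := e ^+ d / D%:R; have c0 : 0 < c by rewrite divr_gt0 // exprn_gt0.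
(* [E] makes [tau ^+ E >= 4], and beyond [M1] the surplus [2 ^ M] absorbs the constant [c ^+ E]. *)
have [E hE] := geometric_domination 4 ler01 tau1 ltr01.
have [M1 hM1] := geometric_domination (c ^- E) (ler0n R 2) (ltr_nat R 2 4) (ltr01).
exists (d * E)%N, (maxn k0 M1) => M k g; rewrite geq_max => /andP[kM MM] Mk g0 gd gv.
rewrite -(ler_nat R) !natrX.
have gR : 0 < g%:R :> R by rewrite ltr0n.
have -> : (v k %/ g)%:R = (v k)%:R / g%:R :> R.
  by rewrite -[in RHS](divnK gv) natrM mulfK // gt_eqF.
(* Divide the lower bound [(e * x ^+ M) ^+ d] by [g ^ d <= D * a ^ M]; [x >= 1] allows replacing [k]
   by [M]. *)
have low : c * tau ^+ M <= ((v k)%:R / g%:R) ^+ d.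
  rewrite [X in _ <= X]expr_div_n ler_pdivlMr ?exprn_gt0 //.
  apply: le_trans (_ : c * tau ^+ M * (D%:R * a%:R ^+ M) <= _).
    rewrite ler_pM2l; last by rewrite mulr_gt0 // exprn_gt0 // (lt_trans ltr01).
    by rewrite -!natrX -natrM ler_nat.
  rewrite /c /tau expr_div_n -exprM.
  have -> : e ^+ d / D%:R * (x ^+ (d * M) / a%:R ^+ M) * (D%:R * a%:R ^+ M) = (e * x ^+ M) ^+ d.
    rewrite exprMn -exprM mulnC; field; rewrite (gt_eqF DR) expf_neq0 // gt_eqF //.
  apply: lerXn2r; rewrite ?nnegrE ?mulr_ge0 ?exprn_ge0 ?(ltW e0) ?(le_trans ler01 x1) //.
  apply: le_trans (hv k (leq_trans kM Mk)).
  by rewrite ler_pM2l // ler_weXn2l.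
rewrite exprM; apply: le_trans (_ : (c * tau ^+ M) ^+ E <= _); last first.
  apply: lerXn2r; rewrite ?nnegrE // ?exprn_ge0 ?divr_ge0 //.
  by rewrite mulr_ge0 ?exprn_ge0 ?ltW // (lt_trans ltr01).
rewrite exprMn exprAC.
have h4 : 4 <= tau ^+ E by have := hE E (leqnn E); rewrite expr1n mulr1 mul1r.
apply: le_trans (_ : c ^+ E * 4 ^+ M <= _); last first.
  by rewrite ler_pM2l ?exprn_gt0 // lerXn2r ?nnegrE // (le_trans _ h4).
have := hM1 M MM; rewrite mul1r => h.
by rewrite mulrC -ler_pdivrMr ?exprn_gt0 // mulrC.
Qed.

(** * Counting in a window *)

Lemma card_bigcup_leq (I T : finType) (F : I -> {set T}) (b : nat) :
  (forall i, #|F i| <= b)%N -> (#|\bigcup_i F i| <= #|I| * b)%N.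
Proof.
move=> hF; apply: leq_trans (_ : \sum_i #|F i| <= _)%N; last first.
  by rewrite -sum_nat_const leq_sum.
elim/big_rec2: _ => [|i x y _ h]; first by rewrite cards0.
by rewrite (leq_trans _ (leq_add (leqnn _) h)) // cardsU leq_subr.
Qed.

Lemma leq_exp2 x : (x <= 2 ^ x)%N.
Proof. exact/ltnW/ltn_expl. Qed.

Lemma leq_exp2r_weak x y e : (x <= y)%N -> (x ^ e <= y ^ e)%N.
Proof. by case: e => // e; rewrite leq_exp2r. Qed.

Lemma card_window M N : #|[set m : 'I_(M + N).+1 | (M < m)%N]| = N.
Proof.
have -> : [set m : 'I_(M + N).+1 | (M < m)%N] = [set (rshift M.+1 i : 'I_(M + N).+1) | i : 'I_N].
  apply/setP => m; rewrite inE; apply/idP/imsetP => [Mm|[i _ ->]]; last first.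
    by rewrite /= leq_addr.
  have lt : (m - M.+1 < N)%N by have := ltn_ord m; lia.
  by exists (Ordinal lt) => //; apply/val_inj; rewrite /= subnKC.
rewrite card_imset ?card_ord // => x y /(congr1 val) /= /eqP.
by rewrite eqn_add2l => /eqP/val_inj.
Qed.

Lemma card_ffun_window_leq M N s (X : {set {ffun 'I_s -> 'I_(M + N).+1}}) :
  (forall f : {ffun 'I_s -> 'I_(M + N).+1}, f \in X -> forall i, (M < f i)%N) ->
  (#|X| <= N ^ s)%N.
Proof.
move=> hX.
have -> : (N ^ s)%N = #|(ffun_on (mem [set m : 'I_(M + N).+1 | (M < m)%N]) :
    pred {ffun 'I_s -> 'I_(M + N).+1})|.
  by rewrite card_ffun_on card_window card_ord.
apply/subset_leq_card/fintype.subsetP => f /hX Mf.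
by apply/ffun_onP => i; rewrite inE.
Qed.

Section Window.
Variables (n : nat) (c : 'I_n.+1 -> int) (u : nat -> int) (K C E M0 s : nat).
Hypothesis u_rec : lin_rec_rel u c.
Local Notation A := (rec_mx c).
Hypothesis detA : \det A != 0.
Hypothesis detH : \det (hankel_mx n.+1 u) != 0.
Hypothesis zeros : forall (H : seq nat) (W : 'cV[int]_n.+1),
  uniq H -> (K <= size H)%N -> (forall h, h \in H -> (A ^+ h *m W) 0 0 = 0) -> W = 0.
Hypothesis C_gt0 : (0 < C)%N.
Hypothesis entry_leq : forall h i j, (`|(A ^+ h)%R i j| <= C ^ h)%N.
Local Notation a := `|\det A|%N.
Local Notation D := `|\det (hankel_mx n.+1 u)|%N.
Hypothesis growth : forall M k g, (M0 <= M)%N -> (M <= k)%N -> (0 < g)%N ->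
  (g ^ n.+1 <= D * a ^ M)%N -> (g %| `|u k.+1|)%N -> (2 ^ M <= (`|u k.+1| %/ g) ^ E)%N.
Hypothesis s_gt0 : (0 < s)%N.

Definition content M := \big[gcdn/0%N]_(i < n.+1) `|(state n.+1 u M.+1 i 0)%R|%N.

Lemma content_dvd M k : (M <= k)%N -> (content M %| `|u k.+1|)%N.
Proof.
move=> Mk; rewrite -(subnKC Mk) -addSn; set h := (k - M)%N.
have -> : u (M.+1 + h)%N = (A ^+ h *m state n.+1 u M.+1) 0 0.
  by rewrite rec_mx_exp_state // mxE addn0.
rewrite -[(_ %| _)%N]/(dvdz (content M) _) mxE; apply: rpred_sum => i _.
apply: dvdz_mull; rewrite dvdzE /= /content (bigD1 i) //=; exact: dvdn_gcdl.
Qed.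

(** [A ^+ M] times the Hankel matrix is the Hankel matrix started at [M + 1], whose entries are all
    divisible by [content M]; take determinants. *)
Lemma content_exp_dvd M : (content M ^ n.+1 %| D * a ^ M)%N.
Proof.
set g := content M.
pose HM : 'M[int]_n.+1 := \matrix_(i, j) (u (M.+1 + i + j)%N %/ g)%Z.
have HE : A ^+ M *m hankel_mx n.+1 u = g%:Z *: HM.
  apply/matrixP => i j; rewrite mxE.
  transitivity ((A ^+ M *m state n.+1 u j.+1) i 0).
    by rewrite mxE; apply: eq_bigr => k _; rewrite !mxE addnAC add1n.
  rewrite rec_mx_exp_state // !mxE mulrC divzK; first by congr u; lia.
  by rewrite addSn addSn dvdzE; apply: content_dvd; lia.
have := congr1 (fun X => `|\det X|%N) HE.
rewrite det_mulmx detZ !abszM abszX absz_nat mulnC.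
have -> : `|\det (A ^+ M)|%N = (a ^ M)%N.
  rewrite -abszX; congr absz; elim: M {g HM HE} => [|M IH]; first by rewrite !expr0 det1.
  by rewrite !exprS det_mulmx IH.
by move=> ->; rewrite dvdn_mulr.
Qed.

Lemma content_gt0 M : (0 < content M)%N.
Proof.
rewrite lt0n; apply: contraTneq (content_exp_dvd M) => ->.
by rewrite exp0n // dvd0n muln_eq0 expn_eq0 !absz_eq0 (negPf detA) (negPf detH).
Qed.

(** The first rows of the powers [A ^+ h], for the indices [M + 1 + h] in [r], form a matrix without
    kernel by the bound on zeros. Some maximal minor is nonzero, has entries at most [C ^ N], and
    bounds [q]. *)
Lemma common_divisor_leq M N (r : seq nat) q :
  uniq r -> (K <= size r)%N ->
  (forall m, m \in r -> [/\ (M < m)%N, (m <= M + N)%N & (q * content M %| `|u m|)%N]) ->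
  (q <= n.+1`! * (C ^ N) ^ n.+1)%N.
Proof.
move=> ur sr hr.
pose H := [seq m - M.+1 | m <- r]%N.
have uH : uniq H.
  by rewrite map_inj_in_uniq // => x y /hr[Mx _ _] /hr[My _ _]; lia.
pose X : 'M[int]_(size H, n.+1) := \matrix_(i, j) (A ^+ nth 0%N H i) 0 j.
have XE (W : 'cV[int]_n.+1) i : (X *m W) i 0 = (A ^+ nth 0%N H i *m W) 0 0.
  by rewrite !mxE; apply: eq_bigr => j _; rewrite mxE.
have [|f detf] := @ker0_minor_neq0 _ _ X.
  move=> W XW; apply: (zeros uH); rewrite ?size_map // => h hH.
  have lt : (index h H < size H)%N by rewrite index_mem.
  by have := XE W (Ordinal lt); rewrite XW mxE nth_index.
have Hin (i : 'I_(size H)) : nth 0%N H i \in H by rewrite mem_nth.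
apply: leq_trans (dvdn_biggcd_leq detf (erefl (content M)) (content_gt0 M) _) _.
  move=> i; have -> : (rowsub f X *m state n.+1 u M.+1) i 0 = (X *m state n.+1 u M.+1) (f i) 0.
    by rewrite !mxE; apply: eq_bigr => j _; rewrite !mxE.
  rewrite XE rec_mx_exp_state // mxE addn0.
  have /mapP[m mr ->] := Hin (f i); have [Mm _ hq] := hr m mr.
  by rewrite subnKC.
apply: absz_det_leq => i j; rewrite !mxE; apply: leq_trans (entry_leq _ _ _) _.
have /mapP[m mr ->] := Hin (f i); have [Mm mN _] := hr m mr.
by rewrite leq_pexp2l //; lia.
Qed.

(** Too many terms would contain [2 ^ K >= K] terms sharing a factor [q] with [B <= q ^ D'],
    exponential in [M], whereas [q] is at most exponential in [N]. *)
Lemma few_large_common_divisors (De E' : nat) : (0 < De)%N ->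
  exists L C0, forall M N (r : seq nat) (B : nat) (F : nat -> nat),
    (0 < N)%N -> (C0 * N <= M)%N -> (0 < B)%N -> (2 ^ M <= B ^ E')%N -> uniq r ->
    (forall m, m \in r -> [/\ (M < m)%N, (m <= M + N)%N,
       (F m * content M %| `|u m|)%N, (F m %| B)%N & (B <= F m ^ De)%N]) ->
    (size r < L)%N.
Proof.
move=> De0; have [L [D' [_ hL]]] := exists_large_gcd_subset nat K De0.
(* The bound on [q] turns [2 ^ M <= q ^ (D' * E')] into an upper bound for [M / N]; the successor
   makes the contradiction strict. *)
exists L, (((n.+1)`! + C * n.+1) * (D' * E')).+1 => M N r B F N0 CM B0 BM ur hr.
rewrite ltnNge; apply/negP => Lr.
have [m mr|r' [q [ur' sub sz hq Bq]]] := hL r F B B0 ur Lr; first by case: (hr m mr).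
have : (q <= n.+1`! * (C ^ N) ^ n.+1)%N.
  apply: (@common_divisor_leq M N r') => // [|m mr'].
    by rewrite sz leq_exp2.
  have [h1 h2 h3 _ _] := hr m (sub m mr'); split=> //.
  by apply: dvdn_trans h3; rewrite dvdn_mul // hq.
have le2 : (n.+1`! * (C ^ N) ^ n.+1 <= 2 ^ (((n.+1)`! + C * n.+1) * N))%N.
  rewrite mulnDl expnD leq_mul //.
    by apply: leq_trans (leq_exp2 _) _; rewrite leq_pexp2l // leq_pmulr.
  rewrite mulnAC [in X in (_ <= X)%N]expnM leq_exp2r // expnM leq_exp2r //; exact: leq_exp2.
move=> q1; have {q1} q2 := leq_trans q1 le2.
have : (2 ^ M <= 2 ^ (((n.+1)`! + C * n.+1) * N * (D' * E')))%N.
  apply: leq_trans BM _; rewrite expnM [in X in (_ <= X)%N]expnM leq_exp2r_weak //.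
  by apply: leq_trans Bq _; rewrite leq_exp2r_weak.
rewrite leq_exp2l //; nia.
Qed.


Definition quot M m := (`|u m| %/ content M)%N.

Lemma quotK M m : (M < m)%N -> (quot M m * content M)%N = `|u m|%N.
Proof. by case: m => // m Mm; rewrite divnK // content_dvd. Qed.

(** The exponent [s] counts the factors [content M ^ s] and the [s - 1] other quotients: one of the
    [s] gcds must have [s]-th power at least the quotient. *)
Definition shares_content M m := (quot M m <= gcdn (quot M m) (content M ^ s) ^ s)%N.

Definition shares_divisor M m m' := (quot M m <= gcdn (quot M m) (quot M m') ^ s)%N.

Lemma quot_growth M m : (M0 <= M)%N -> (M < m)%N -> (2 ^ M <= quot M m ^ E)%N.
Proof.
case: m => // m M0M Mm; apply: growth => //; first exact: content_gt0.
  by rewrite dvdn_leq ?content_exp_dvd // muln_gt0 expn_gt0 !absz_gt0 detA detH.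
exact: content_dvd.
Qed.

Lemma quot_gt0 M m : (0 < M)%N -> (M0 <= M)%N -> (M < m)%N -> (0 < quot M m)%N.
Proof.
move=> M1 M0M Mm; rewrite lt0n; apply: contraTneq (quot_growth M0M Mm) => ->.
rewrite -ltnNge; case: E => [|e]; last by rewrite exp0n // expn_gt0.
by rewrite expn0 -{1}(expn0 2) ltn_exp2l.
Qed.

(** All these gcds divide one integer depending only on [M], a multiple of [content M ^ s]. *)
Lemma few_shares_content : exists L C0, forall M N (S : {set 'I_(M + N).+1}),
  (0 < N)%N -> (C0 * N <= M)%N ->
  (forall m, m \in S -> (M < m)%N /\ shares_content M m) -> (#|S| <= L)%N.
Proof.
(* Each gcd [G] has [2 ^ M <= G ^ (s * E)], and the common multiple is at most
   [2 ^ (M * (D + 1 + a) * s)]; the successor makes the exponent positive. *)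
have [|L [C0 hL]] := @few_large_common_divisors (s * E * (s * (D + 1 + a))).+1 1; first by [].
exists L, (C0 + M0 + 1)%N => M N S N0 CM hS; rewrite cardE -(size_map val).
have M0M : (M0 <= M)%N by apply: leq_trans CM; nia.
have M1 : (0 < M)%N by apply: leq_trans CM; nia.
have D0 : (0 < D)%N by rewrite absz_gt0.
have a0 : (0 < a)%N by rewrite absz_gt0.
(* [D * a ^ M] is a multiple of [content M], and the factor [2 ^ M] ensures the required size. *)
apply/ltnW/(hL M N _ ((2 ^ M * (D * a ^ M)) ^ s)%N
  (fun m => gcdn (quot M m) (content M ^ s))) => //.
- by apply: leq_trans CM; nia.
- by rewrite expn_gt0 !muln_gt0 !expn_gt0 a0 D0.
- rewrite expn1; apply: leq_trans (_ : (2 ^ M * (D * a ^ M)) ^ 1 <= _)%N.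
    by rewrite expn1 leq_pmulr // muln_gt0 D0 expn_gt0 a0.
  by rewrite leq_pexp2l // !muln_gt0 !expn_gt0 a0 D0.
- by rewrite (map_inj_uniq val_inj) enum_uniq.
move=> _ /mapP[m + ->]; rewrite mem_enum => /hS[Mm sh]; split=> //.
- by rewrite -ltnS ltn_ord.
- by rewrite -(quotK Mm) dvdn_mul // dvdn_gcdl.
- apply: dvdn_trans (dvdn_gcdr _ _) _; apply: dvdn_exp2r.
  rewrite dvdn_mull //; apply: dvdn_trans (content_exp_dvd M).
  by rewrite -{1}(expn1 (content M)) dvdn_exp2l.
set G := gcdn _ _.
have G0 : (0 < G)%N by rewrite gcdn_gt0 quot_gt0.
have le1 : (2 ^ M <= G ^ (s * E))%N.
  by apply: leq_trans (quot_growth M0M Mm) _; rewrite expnM leq_exp2r_weak.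
have le2 : (2 ^ M * (D * a ^ M) <= 2 ^ (M * (D + 1 + a)))%N.
  rewrite mulnDr mulnDr muln1 !expnD -mulnA [(2 ^ M * _)%N]mulnCA leq_mul //.
    by apply: leq_trans (leq_exp2 _) _; rewrite leq_pexp2l // leq_pmull.
  by rewrite leq_mul // mulnC expnM leq_exp2r_weak // leq_exp2.
apply: leq_trans (leq_exp2r_weak s le2) _.
rewrite -expnM -mulnA expnM.
apply: leq_trans (leq_exp2r_weak _ le1) _; rewrite -expnM leq_pexp2l //.
by rewrite [((D + 1 + a) * s)%N]mulnC.
Qed.

(** Here [B] is the quotient at the fixed index [m], large by the growth bound. *)
Lemma few_shares_divisor : exists L C0, forall M N m (S : {set 'I_(M + N).+1}),
  (0 < N)%N -> (C0 * N <= M)%N -> (M < m)%N ->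
  (forall m', m' \in S -> (M < m')%N /\ shares_divisor M m m') -> (#|S| <= L)%N.
Proof.
have [L [C0 hL]] := @few_large_common_divisors s E s_gt0.
exists L, (C0 + M0 + 1)%N => M N m S N0 CM Mm hS; rewrite cardE -(size_map val).
have M0M : (M0 <= M)%N by apply: leq_trans CM; nia.
have M1 : (0 < M)%N by apply: leq_trans CM; nia.
apply/ltnW/(hL M N _ (quot M m) (fun m' => gcdn (quot M m) (quot M m'))) => //.
- by apply: leq_trans CM; nia.
- exact: quot_gt0.
- exact: quot_growth.
- by rewrite (map_inj_uniq val_inj) enum_uniq.
move=> _ /mapP[m' + ->]; rewrite mem_enum => /hS[Mm' sh]; split=> //.
- by rewrite -ltnS ltn_ord.
- by rewrite -(quotK Mm') dvdn_mul // dvdn_gcdr.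
exact: dvdn_gcdl.
Qed.

(** After cancelling contents, the quotient at [i] is at most a product of [s] gcds, one of which
    must be large. *)
Lemma dvdn_prod_shares M (f : 'I_s -> nat) i :
  (0 < M)%N -> (M0 <= M)%N -> (forall j, (M < f j)%N) ->
  (`|u (f i)| %| \prod_(j < s | j != i) `|u (f j)|)%N ->
  shares_content M (f i) \/ exists2 j, j != i & shares_divisor M (f i) (f j).
Proof.
move=> M1 M0M Mf; pose q j := quot M (f j); pose g := content M.
have q0 j : (0 < q j)%N by exact: quot_gt0.
have cs : #|[pred j | j != i]| = s.-1 by rewrite -[s in RHS]card_ord -(cardC1 i).
rewrite -(quotK (Mf i)) (eq_bigr (fun j => q j * g)%N); last by move=> j _; rewrite quotK.
rewrite big_split /= prod_nat_const => dv.
have {dv} dv : (q i %| g ^ s * \prod_(j < s | j != i) q j)%N.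
  have -> : (g ^ s = g * g ^ s.-1)%N by rewrite -expnS prednK.
  rewrite -mulnA dvdn_mull // mulnC -cs.
  by apply: dvdn_trans dv; rewrite dvdn_mulr.
have {dv} dv : (q i <= gcdn (q i) (g ^ s) * \prod_(j < s | j != i) gcdn (q i) (q j))%N.
  apply: dvdn_leq.
    by rewrite muln_gt0 gcdn_gt0 q0; apply: prodn_gt0 => j; rewrite gcdn_gt0 q0.
  have: (q i %| gcdn (q i) (g ^ s * \prod_(j < s | j != i) q j))%N by rewrite dvdn_gcd dvdnn.
  move/dvdn_trans; apply; apply: dvdn_trans (gcdn_mul_dvd _ _ _) _.
  exact/dvdn_mul/gcdn_prod_dvd.
have [sc|nsc] := boolP (shares_content M (f i)); first by left.
have [/existsP[j /andP[nj sd]]|nsd] := boolP [exists j, (j != i) && shares_divisor M (f i) (f j)].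
  by right; exists j.
exfalso; have := leq_exp2r_weak s dv; rewrite leqNgt => /negP; apply.
rewrite expnMn (big_morph (expn^~ s) (fun x y => expnMn x y s) (exp1n s)).
(* Strictness comes from the content factor, which is present even when [s = 1]. *)
apply: leq_ltn_trans (_ : gcdn (q i) (g ^ s) ^ s * q i ^ s.-1 < _)%N.
  rewrite leq_mul2l; apply/orP; right; rewrite -cs -prod_nat_const.
  apply: leq_prod => j nj; rewrite ltnW // ltnNge; apply: contra nsd => sd.
  by apply/existsP; exists j; rewrite nj.
have -> : (q i ^ s = q i * q i ^ s.-1)%N by rewrite -expnS prednK.
rewrite ltn_pmul2r ?expn_gt0 ?q0 //.
by rewrite ltnNge.
Qed.

Lemma card_dvdn_prod_leq : exists L C0, forall M N (X : {set {ffun 'I_s -> 'I_(M + N).+1}}),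
  (0 < N)%N -> (C0 * N <= M)%N ->
  (forall f : {ffun 'I_s -> 'I_(M + N).+1}, f \in X -> (forall i, (M < f i)%N) /\
     exists i, (`|u (f i)| %| \prod_(j < s | j != i) `|u (f j)|)%N) ->
  (#|X| <= L * N ^ s.-1)%N.
Proof.
have [L1 [C1 h1]] := few_shares_content; have [L2 [C2 h2]] := few_shares_divisor.
exists (s * s * maxn L1 L2)%N, (C1 + C2 + M0 + 1)%N => M N X N0 CM hX.
have M0M : (M0 <= M)%N by apply: leq_trans CM; nia.
have M1 : (0 < M)%N by apply: leq_trans CM; nia.
pose W := [set m : 'I_(M + N).+1 | (M < m)%N].
have cW : (#|W| = N)%N by exact: card_window.
(* The pair [(i, i)] encodes sharing with the content, [(i, j)] sharing between two coordinates;
   either way the set constraining coordinate [j] does not depend on [f j]. *)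
pose S (i j : 'I_s) (f : {ffun 'I_s -> 'I_(M + N).+1}) : {set 'I_(M + N).+1} :=
  if i == j then [set m in W | shares_content M m]
  else [set m in W | shares_divisor M (f i) m].
pose Y (p : 'I_s * 'I_s) := [set f : {ffun 'I_s -> 'I_(M + N).+1} |
  [forall i, f i \in W] && (f p.2 \in S p.1 p.2 f)].
have XY : X \subset \bigcup_p Y p.
  apply/fintype.subsetP => f /hX[Mf [i /dvdn_prod_shares]] => /(_ M M1 M0M Mf) sh.
  have fW : [forall i, f i \in W] by apply/forallP => j; rewrite inE Mf.
  case: sh => [sc|[j nj sd]]; apply/finset.bigcupP.
    by exists (i, i); rewrite // inE fW /= /S eqxx !inE Mf.
  by exists (i, j); rewrite // inE fW /= /S eq_sym (negPf nj) !inE Mf.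
apply: leq_trans (subset_leq_card XY) _.
have -> : (s * s * maxn L1 L2 * N ^ s.-1 = #|{: 'I_s * 'I_s}| * (maxn L1 L2 * N ^ s.-1))%N.
  by rewrite card_prod card_ord mulnA.
apply: card_bigcup_leq => -[i j].
have -> : (N ^ s.-1 = #|W| ^ #|'I_s|.-1)%N by rewrite cW card_ord.
apply: card_ffun_coord_leq => [|f g fg|f fW] /=; first exact: ord0.
  by rewrite /S; case: eqP => // /eqP nij; rewrite fg.
rewrite /S; case: eqP => _.
  apply: leq_trans (leq_maxl _ _); apply: h1 => //; first by apply: leq_trans CM; nia.
  by move=> m; rewrite !inE => /andP.
apply: leq_trans (leq_maxr _ _); apply: (h2 M N (f i)) => //.
- by apply: leq_trans CM; nia.
- by have := fW i; rewrite inE.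
by move=> m; rewrite !inE => /andP.
Qed.

End Window.

(** * The threshold on [M] *)

(** With [r] the square root of [N], the exponent is at least [r / 4], and [expR (r / 4) >= (r / 16)
    ^ 4 = N ^ 2 / 16 ^ 4], which beats [C0 * N] once [N >= C0 * 16 ^ 4]. *)
Lemma iter_log_threshold (R : realType) (C0 : nat) : exists N0, forall N M : nat,
  (N0 <= N)%N ->
  expR (N%:R * iter_log 3 N%:R / iter_log 2 N%:R) <= M%:R :> R -> (C0 * N <= M)%N.
Proof.
exists (C0 * 16 ^ 4 + 1)%N => N M N0 hM; rewrite -(ler_nat R); apply: le_trans hM.
have N1 : (1 : R) <= N%:R by rewrite ler1n (leq_trans _ N0) // addn1.
pose r : R := Num.sqrt N%:R.
have rN : r ^+ 2 = N%:R by rewrite sqr_sqrtr.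
have r1 : 1 <= r by rewrite -sqrtr1 ler_sqrt.
have r0 : 0 < r by apply: lt_le_trans r1.
have ln2 : 2^-1 <= ln (2 : R).
  have := @le_ln1Dx R (- 2^-1); rewrite (_ : 1 + - 2^-1 = 2^-1 :> R); last by lra.
  by rewrite lnV ?posrE //; lra.
(* Now [iter_log 2] is [ln y] and [iter_log 3] is [ln z]; the truncations at [2] keep both
   positive. *)
rewrite /=; set y := Num.max (ln N%:R) 2; set z := Num.max (ln y) 2.
have y2 : 2 <= y by rewrite le_max lexx orbT.
have y0 : 0 < y by apply: lt_le_trans y2.
have yr : y <= 2 * r.
  rewrite ge_max; apply/andP; split; last by lra.
  have lnr2 : ln r *+ 2 = 2 * ln r by rewrite mulr_natl.
  by rewrite -rN lnXn // lnr2 ler_pM2l // ltW // ln_sublinear.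
have lny0 : 0 < ln y by apply: lt_le_trans (_ : ln 2 <= _); [lra | rewrite ler_ln ?posrE].
have lnyr : ln y <= 2 * r by apply: le_trans yr; rewrite ltW // ln_sublinear.
have lnz : 2^-1 <= ln z.
  by apply: le_trans ln2 _; rewrite ler_ln ?posrE // ?le_max ?lexx ?orbT // lt_max ltr0n orbT.
have le1 : r / 4 <= N%:R * ln z / ln y.
  rewrite ler_pdivlMr // -rN.
  apply: le_trans (_ : r / 4 * (2 * r) <= _); first by rewrite ler_pM2l // divr_gt0.
  by rewrite (_ : r / 4 * (2 * r) = r ^+ 2 * 2^-1) ?ler_pM2l ?exprn_gt0 //; field.
apply: le_trans (_ : expR (r / 4) <= _); last by rewrite ler_expR.
have -> : r / 4 = 4%:R * (r / 16) by field.
rewrite expRM_natl.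
apply: le_trans (_ : (r / 16) ^+ 4 <= _); last first.
  apply: lerXn2r; rewrite ?nnegrE ?expR_ge0 ?divr_ge0 // ?ltW //.
  by apply: lt_le_trans (expR_ge1Dx _); rewrite ltrDr.
rewrite expr_div_n (exprM r 2 2) rN ler_pdivlMr ?exprn_gt0 // expr2 natrM mulrAC.
rewrite ler_pM2r ?(lt_le_trans ltr01 N1) // -natrX -natrM ler_nat.
by apply: leq_trans N0; rewrite leq_addr.
Qed.

(** * Assembly of the counting bound *)

Local Open Scope classical_set_scope.
Local Open Scope ring_scope.

Theorem mainTheorem5 (R : realType) (u : nat -> int) (d : nat)
    (c : 'I_d -> int)
    (d_ge2 : (2 <= d)%N)
    (u_lrs : lin_rec_seq u c)
    (u_simple : no_multiple_root R (rec_char_poly c))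
    (u_nondeg : nondegenerate_poly R (rec_char_poly c))
    (u_dom : has_dominant_root R (rec_char_poly c))
    (s : nat) (s_ge1 : (1 <= s)%N) :
  exists (C : R) (eps : nat -> R),
    [/\ 0 < C,
        eps @ \oo --> (0 : R)
      & forall N M : nat, (1 <= N)%N ->
          expR (N%:R * iter_log 3 N%:R / iter_log 2 N%:R) <= M%:R :> R ->
          (count_mult_dependent R u s M N)%:R
            <= C * (N%:R `^ (s%:R - 1 + eps N))].
Proof.
case: d c d_ge2 u_lrs u_simple u_nondeg u_dom => [|n] c d_ge2 // u_lrs u_simple u_nondeg u_dom.
have [_ u_rec _] := u_lrs; have [c0 nondeg] := u_nondeg.
have [l [l_inj l_root l_all]] := rec_char_poly_roots u_simple.
have n0 : (0 < n)%N by [].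
have detH := det_hankel_neq0 n0 u_lrs.
have l0 j : l j != 0.
  apply: contraNneq c0 => lj0; have := l_root j.
  by rewrite lj0 /root horner_coef0 coef_map intr_eq0.
have detl := det_rec_mx l_inj l_root.
have detA : \det (rec_mx c) != 0.
  by rewrite -(intr_eq0 R[i]) detl; apply/prodf_neq0 => j _.
(* Equal [T]-th powers would make the ratio of two distinct roots a root of unity. *)
have lT_inj T : (0 < T)%N -> forall i j, l i ^+ T = l j ^+ T -> i = j.
  move=> T0 i j lij; apply: contra_eq (lij) => nij.
  have nl : l i != l j by apply: contra_neq nij; apply: l_inj.
  have := nondeg _ _ (l_root i) (l_root j) nl T T0.
  by apply: contra => /eqP ll; rewrite unity_rootE expr_div_n ll divff // expf_neq0.
have [K hK] := exp_mx_entry_zeros detA (fun T W T0 => rec_mx_free l_inj l_root (lT_inj T T0)).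
have [C C0 hC] := absz_exp_mx_entry_leq (rec_mx c).
have [b [ub b0]] := rec_mx_hankel_coef l_inj l_root u_rec detH.
have [lam lam_root lam_dom] := u_dom.
have [j0 lamE] := l_all lam lam_root.
have dom j : j != j0 -> normc (l j) < normc (l j0).
  move=> nj; have : l j != lam by rewrite lamE; apply: contra_neq nj; apply: l_inj.
  by move=> /(lam_dom _ (l_root j)); rewrite lamE ltcR.
have [e [k0 [e0 hk0]]] := dominant_sum_lower_bound (b0 j0) dom.
pose a := `|\det (rec_mx c)|%N; pose D := `|\det (hankel_mx n.+1 u)|%N.
have a0 : (0 < a)%N by rewrite absz_gt0.
have D0 : (0 < D)%N by rewrite absz_gt0.
(* The determinant is the product of the roots; the inequality is strict because [n > 0] provides a
   root besides the dominant one. *)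
have lt_a : a%:R < normc (l j0) ^+ n.+1.
  rewrite /a -normc_int detl normc_prod (bigD1 j0) //= exprS ltr_pM2l; last first.
    by rewrite lt_def normc_ge0 andbT; apply: contra_neq (l0 j0); apply: eq0_normc.
  have -> : normc (l j0) ^+ n = \prod_(j < n.+1 | j != j0) normc (l j0).
    by rewrite prodr_const (cardC1 j0) card_ord.
  apply: ltr_prod => [|j nj]; last by rewrite normc_ge0 dom.
  by apply/hasP; exists (lift j0 (Ordinal n0)); rewrite ?mem_index_enum // eq_sym neq_lift.
(* Otherwise the positive integer [a] would be below [1]. *)
have x1 : 1 <= normc (l j0).
  rewrite leNgt; apply/negP => /ltW lt1.
  have := lt_le_trans lt_a (exprn_ile1 _ (normc_ge0 _) lt1).
  by rewrite ltNge ler1n a0.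
have v_low k : (k0 <= k)%N -> e * normc (l j0) ^+ k <= (`|u k.+1|%N)%:R.
  by move=> /hk0; rewrite -ub normc_int.
have [E [M0 growth]] := quotient_growth e0 a0 D0 lt_a x1 v_low.
have [L [C1 count]] := card_dvdn_prod_leq u_rec detA detH hK C0 hC growth s_ge1.
have [N0 threshold] := iter_log_threshold R C1.
(* [L] serves [N >= N0]; below that the trivial bound [N ^ s <= N0 * N ^ s.-1] suffices. *)
exists ((L + N0).+1)%:R, (fun=> 0); split; [by rewrite ltr0n|exact: cvg_cst|].
move=> N M N1 hM.
have -> : s%:R - 1 + 0 = (s.-1)%:R :> R.
  by rewrite addr0 -[s in LHS](prednK s_ge1) -natr1 addrK.
rewrite powR_mulrn // -natrX -natrM ler_nat /count_mult_dependent.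
set X := [set f | _]%SET.
have XM (f : {ffun 'I_s -> 'I_(M + N).+1}) : f \in X -> (forall i, (M < f i)%N) /\
    exists i, (`|u (f i)| %| \prod_(j < s | j != i) `|u (f j)|)%N.
  rewrite inE => /andP[/forallP Mf /asboolP[u0 [k k_n0 prod1]]]; split.
    by move=> i; have := Mf i; rewrite addn1.
  by apply: prod_exprz_eq1_dvdn k_n0 prod1 => i; have := u0 i; rewrite intr_eq0.
have [lt_N|le_N] := ltnP N N0.
  apply: leq_trans (card_ffun_window_leq (fun f fX => (XM f fX).1)) _.
  rewrite -[s in (N ^ s)%N](prednK s_ge1) expnS leq_mul2r; apply/orP; right.
  by lia.
apply: leq_trans (count M N X N1 (threshold N M le_N hM) XM) _.
by rewrite leq_mul2r; apply/orP; right; lia.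
Qed.
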